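(* Let $X$ be a random variable with values in $\mathbb{R}^d$ such that $\mathbb{E}[|X|]<\infty$. (i) One has $$\mathbb{E}\big[\tilde V_0(X)\big]=\mathbb{E}\Big[\inf_{\alpha\in\mathcal{G}^N}\sup_{b\in B^N}\tilde J_0(X,\alpha[b],b)\Big]=\inf_{\alpha\in\mathcal{G}^N}\sup_{b\in\mathcal{B}^N}\mathbb{E}\big[\tilde J_0(X,\alpha[b],b)\big].$$ (ii) Assume furthermore that $X$ admits a Lebesgue measurable density $\rho$ supported on $\overline{\Omega}$ for some $\Omega\subset\mathbb{R}^d$, such that $\rho(x)>0$ for a.e. $x\in\Omega$ and $\partial\Omega$ is Lebesgue-negligible, and that $\alpha^*\in\mathcal{G}^N$ is optimal in the right-hand side above (i.e. attains the infimum over $\alpha\in\mathcal{G}^N$). Then $\alpha^*$ is an optimal strategy for $\tilde V_0(x)$ in the sense that $$\tilde V_0(x)=\sup_{b\in B^N}\tilde J_0(x,\alpha^*[b],b)\quad\text{for a.e. }x\in\Omega.$$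
   Context: Let $N\ge1$; $A\subset\mathbb{R}^{n_A}$, $B\subset\mathbb{R}^{n_B}$ ($n_A,n_B\ge1$) are non-empty compact sets; $g,\varphi:\mathbb{R}^d\to\mathbb{R}$ are Lipschitz continuous; $f:\mathbb{R}^d\times A\times B\to\mathbb{R}^d$ is Lipschitz continuous. $F:\mathbb{R}^d\times A\times B\to\mathbb{R}^d$ is a one time-step approximation of the dynamics $\dot y=f(y,a,b)$ with time step $\tau=T/N$, $T>0$, and is assumed at least continuous in its variables; the simplest example is the Euler scheme $F(x,a,b)=x+\tau f(x,a,b)$. Write $p\vee q=\max(p,q)$, let $\mathrm{Meas}(X,Y)$ denote the set of measurable functions from $X$ to $Y$, and set $\mathcal{G}=\mathrm{Meas}(\mathbb{R}^d\times B,A)$, $\mathcal{B}=\mathrm{Meas}(\mathbb{R}^d,B)$. For $\alpha=(\alpha_0,\dots,\alpha_{N-1})\in\mathcal{G}^N$ and $b=(b_0,\dots,b_{N-1})\in\mathcal{B}^N$ set $$\tilde J_0(x,\alpha[b],b)=\Big(\max_{0\le k\le N-1}g(\tilde x_k)\Big)\vee\varphi(\tilde x_N),$$ where $\tilde x_0=x$ and $\tilde x_{k+1}=F(\tilde x_k,\alpha_k(\tilde x_k,b_k(\tilde x_k)),b_k(\tilde x_k))$ for $k\ge0$. For $b\in B^N$ (constant $b_k$) the same definition is used with $b_k(\tilde x_k)=b_k$. Finally $$\tilde V_0(x)=\inf_{\alpha\in\mathcal{G}^N}\sup_{b\in B^N}\tilde J_0(x,\alpha[b],b).$$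
   Formalization: In (ii), the optimal α* is additionally assumed to have finite worst-case mean cost sup_b E[J̃_0(X,α*[b],b)] < +∞; for F merely continuous all these expectations can be +∞, so every strategy attains the infimum and the claim fails. *)

(* Defs.v *)
From HB Require Import structures.
From mathcomp Require Import all_boot all_order all_algebra.
From mathcomp Require Import all_classical all_reals all_analysis.
From mathcomp Require Import measurable_realfun.

Set Implicit Arguments.
Unset Strict Implicit.
Unset Printing Implicit Defensive.
Import Order.TTheory GRing.Theory Num.Theory.
Import numFieldNormedType.Exports.

Local Open Scope classical_set_scope.
Local Open Scope ring_scope.

(* Matrices, hence R^n = 'rV[R]_n, carry their Borel sigma-algebra. *)
HB.instance Definition _ (R : realType) (m n : nat) :=
  @isMeasurable.Build (sigma_display (@open 'M[R]_(m, n))) 'M[R]_(m, n)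
    <<s @open 'M[R]_(m, n) >> (@sigma_algebra0 _ setT _) (@sigma_algebraC _ _)
    (@sigma_algebra_bigcup _ setT _).

Section borel_rV.
Context (R : realType).

Lemma open_measurable_mx m n (U : set 'M[R]_(m, n)) : open U -> measurable U.
Proof. by move=> oU; exact: sub_sigma_algebra. Qed.

Lemma open_mx_bigcup_rat m n (U : set 'M[R]_(m, n)) : open U ->
  U = \bigcup_(p in [set p : 'M[rat]_(m, n) * nat |
         ball (map_mx ratr p.1 : 'M[R]_(m, n)) p.2.+1%:R^-1 `<=` U])
      ball (map_mx ratr p.1 : 'M[R]_(m, n)) p.2.+1%:R^-1.
Proof.
move=> oU; apply/seteqP; split=> [x Ux|x [p /= pU]]; last exact: pU.
have /nbhs_ballP[e /= e0 eU] : nbhs x U by exact: open_nbhs_nbhs.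
have [k ke] : exists k : nat, k.+1%:R^-1 + k.+1%:R^-1 <= e.
  exists (Num.truncn (2 / e)).
  have h : (2 / e) < (Num.truncn (2 / e)).+1%:R by exact: truncnS_gt.
  rewrite -mulr2n -[leLHS]mulr_natl ler_pdivrMr ?ltr0n// mulrC.
  by rewrite -ler_pdivrMr// ltW.
have k0 : (0 : R) < k.+1%:R^-1 by rewrite invr_gt0 ltr0n.
have qP i j : exists q : rat, `|x i j - ratr q| < k.+1%:R^-1.
  have [| |y [/= xy [q _ qyE]]] := @dense_rat R (ball (x i j) k.+1%:R^-1).
  - by exists (x i j); exact: ballxx.
  - exact: ball_open.
  - by exists q; rewrite qyE; move: xy; rewrite -ball_normE.
pose q : 'M[rat]_(m, n) := \matrix_(i, j) sval (cid (qP i j)).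
exists (q, k) => /=.
  move=> y qy; apply: eU; apply: le_ball ke _ _.
  apply: (ball_triangle _ qy); split=> // i j; rewrite !mxE.
  by rewrite -ball_normE /=; exact: (svalP (cid (qP i j))).
split=> // i j; rewrite !mxE -ball_normE /= distrC.
exact: (svalP (cid (qP i j))).
Qed.

Lemma measurable_fun_mx d (T : measurableType d) m n (f : T -> 'M[R]_(m, n)) :
  (forall i j, measurable_fun setT (fun x => f x i j)) -> measurable_fun setT f.
Proof.
move=> mf; apply: (@measurability _ _ _ _ _ _ (@open 'M[R]_(m, n))) => //.
move=> _ [U oU <-]; rewrite setTI (open_mx_bigcup_rat oU) preimage_bigcup bigcup_mkcond.
apply: countable_bigcupT_measurable.
- exact: countableP.
- move=> [q k]; case: ifP => //= _.
  rewrite (_ : _ @^-1` _ = \bigcap_(ij in [set: 'I_m * 'I_n])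
      [set x | ball (ratr (q ij.1 ij.2) : R) k.+1%:R^-1 (f x ij.1 ij.2)]).
    apply: fin_bigcap_measurable => // -[i j] _ /=.
    rewrite -[X in measurable X]setTI.
    apply: mf => //; exact: measurable_ball.
  apply/seteqP; split => [x /= [_ h] [i j] _ /=|x /= h].
    by have := h i j; rewrite mxE.
  split=> [|i j]; first by rewrite invr_gt0 ltr0n.
  by have /= := h (i, j) Logic.I; rewrite mxE.
Qed.

Lemma measurable_coord_mx m n (i : 'I_m) (j : 'I_n) :
  measurable_fun setT (fun M : 'M[R]_(m, n) => M i j).
Proof.
apply: (measurability _ (RGenOpens.measurableE R)).
move=> _ [_ [a [b ->] <-]]; rewrite setTI; apply: open_measurable_mx.
apply: open_comp => [x _|]; [exact: coord_continuous|exact: interval_open].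
Qed.

Definition cons_rV n (p : 'rV[R]_n * R) : 'rV[R]_n.+1 :=
  \row_i (if unlift ord0 i is Some j then p.1 ord0 j else p.2).

Lemma measurable_cons_rV n :
  measurable_fun setT (@cons_rV n : 'rV[R]_n * measurableTypeR R -> 'rV[R]_n.+1).
Proof.
apply: measurable_fun_mx => i j; rewrite /cons_rV.
under eq_fun do rewrite mxE.
case: unliftP => [k _|_]; last exact: measurable_snd.
exact: measurableT_comp (measurable_coord_mx _ _) measurable_fst.
Qed.

Lemma measurable_box_rV n (a b : 'rV[R]_n) :
  measurable [set x : 'rV[R]_n | forall i, a ord0 i <= x ord0 i <= b ord0 i].
Proof.
rewrite (_ : mkset _ = \bigcap_(i in [set: 'I_n])
    (fun x : 'rV[R]_n => x ord0 i) @^-1` `[a ord0 i, b ord0 i]).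
  apply: fin_bigcap_measurable => // i _.
  rewrite -[X in measurable X]setTI; exact: measurable_coord_mx.
apply/seteqP; split=> x /= h i; first by move=> _; rewrite /= in_itv /= h.
by have := h i Logic.I; rewrite /= in_itv.
Qed.

End borel_rV.

Section lebesgue_rV.
Context (R : realType).
Local Open Scope ereal_scope.

Section step.
Context n (mu : {measure set 'rV[R]_n -> \bar R}).

Definition lebesgue_rV_step : set 'rV[R]_n.+1 -> \bar R :=
  pushforward (mu \x lebesgue_measure) (@cons_rV R n).

Let step0 : lebesgue_rV_step set0 = 0.
Proof. by rewrite /lebesgue_rV_step /pushforward preimage_set0 measure0. Qed.

Let step_ge0 A : 0 <= lebesgue_rV_step A.
Proof. exact: (measure_ge0 (mu \x lebesgue_measure)). Qed.

Let mpreimage (A : set 'rV[R]_n.+1) : measurable A ->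
  measurable (@cons_rV R n @^-1` A : set ('rV[R]_n * measurableTypeR R)).
Proof.
by move=> mA; rewrite -[X in measurable X]setTI; exact: measurable_cons_rV.
Qed.

Let step_sigma_additive : semi_sigma_additive lebesgue_rV_step.
Proof.
move=> F mF tF mUF; rewrite /lebesgue_rV_step /pushforward preimage_bigcup.
apply: measure_semi_sigma_additive => [k||]; first exact: mpreimage.
  apply/trivIsetP => i j _ _ ij; rewrite -preimage_setI.
  by move/trivIsetP : tF => /(_ _ _ _ _ ij) ->//; rewrite preimage_set0.
by rewrite -preimage_bigcup; exact: mpreimage.
Qed.

HB.instance Definition _ := isMeasure.Build _ _ _
  lebesgue_rV_step step0 step_ge0 step_sigma_additive.

End step.

(* Lebesgue measure on (the Borel sets of) R^n. *)
Fixpoint lebesgue_rV n : {measure set 'rV[R]_n -> \bar R} :=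
  if n is n'.+1 then lebesgue_rV_step (lebesgue_rV n')
  else \d_(0%R : 'rV[R]_0).

Lemma lebesgue_rV_box n (a b : 'rV[R]_n) :
  (forall i, (a ord0 i <= b ord0 i)%R) ->
  lebesgue_rV n
    [set x : 'rV[R]_n | forall i, (a ord0 i <= x ord0 i <= b ord0 i)%R] =
  (\prod_(i < n) (b ord0 i - a ord0 i))%:E.
Proof.
elim: n a b => [|n IH] a b ab /=.
  rewrite big_ord0 diracE mem_set//= => -[].
  by [].
pose tl (v : 'rV[R]_n.+1) : 'rV[R]_n := (\row_i v ord0 (lift ord0 i))%R.
rewrite /lebesgue_rV_step /pushforward.
rewrite (_ : _ @^-1` _ = [set x : 'rV[R]_n | forall i,
     (tl a ord0 i <= x ord0 i <= tl b ord0 i)%R] `*`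
     `[a ord0 ord0, b ord0 ord0]); last first.
  apply/seteqP; split=> -[x y] /=.
    move=> h; split=> [i|].
      by have := h (lift ord0 i); rewrite /cons_rV !mxE liftK.
    by have := h ord0; rewrite in_itv /cons_rV mxE unlift_none.
  move=> [h]; rewrite in_itv /= => hy i; rewrite /cons_rV mxE /=.
  by case: unliftP => [j ->|->//]; have := h j; rewrite !mxE.
rewrite product_measure1E; [|exact: measurable_box_rV|exact: measurable_itv].
rewrite IH => [|i]; last by rewrite !mxE.
rewrite /= lebesgue_measure_itv /= lte_fin big_ord_recl muleC.
under eq_bigr do rewrite !mxE.
case: ltP => [_|ba]; first by rewrite -EFinB -EFinM.
have -> : (b ord0 ord0 - a ord0 ord0 = 0)%R.
  by apply/eqP; rewrite subr_eq0 eq_le ba ab.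
by rewrite mul0e mul0r.
Qed.

End lebesgue_rV.

Section game.
Context (R : realType) (d nA nB N : nat).
Local Notation state := 'rV[R]_d.
Local Notation strategy := ('rV[R]_d * 'rV[R]_nB -> 'rV[R]_nA).
Local Notation control := ('rV[R]_d -> 'rV[R]_nB).

(* Meas(R^d x B, A), its elements being extended arbitrarily outside R^d x B. *)
Definition strategies (A : set 'rV[R]_nA) (B : set 'rV[R]_nB) : set strategy :=
  [set al | measurable_fun ([set: state] `*` B) al /\
            forall x c, B c -> A (al (x, c))].

Definition controls (B : set 'rV[R]_nB) : set control :=
  [set b | measurable_fun [set: state] b /\ forall x, B (b x)].

Definition power (T : Type) (S : set T) : set (N.-tuple T) :=
  [set u | forall i, S (tnth u i)].

Fixpoint traj (F : state -> 'rV[R]_nA -> 'rV[R]_nB -> state)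
    (al : N.-tuple strategy) (b : N.-tuple control) (x : state) (k : nat) :
    state :=
  if k is k'.+1 then
    let y := traj F al b x k' in
    let c := nth (fun=> 0) b k' y in
    F y (nth (fun=> 0) al k' (y, c)) c
  else x.

(* The terminal cost is the base value of the iterated maximum. *)
Definition cost (F : state -> 'rV[R]_nA -> 'rV[R]_nB -> state)
    (g phi : state -> R) (al : N.-tuple strategy) (b : N.-tuple control)
    (x : state) : R :=
  \big[Num.max/phi (traj F al b x N)]_(k < N) g (traj F al b x k).

Definition const_controls (b : N.-tuple 'rV[R]_nB) : N.-tuple control :=
  map_tuple (fun c : 'rV[R]_nB => (fun=> c) : control) b.

Definition worst_cost (B : set 'rV[R]_nB)
    (F : state -> 'rV[R]_nA -> 'rV[R]_nB -> state) (g phi : state -> R)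
    (al : N.-tuple strategy) (x : state) : \bar R :=
  ereal_sup [set (cost F g phi al (const_controls b) x)%:E | b in power B].

Definition value (A : set 'rV[R]_nA) (B : set 'rV[R]_nB)
    (F : state -> 'rV[R]_nA -> 'rV[R]_nB -> state) (g phi : state -> R)
    (x : state) : \bar R :=
  ereal_inf [set worst_cost B F g phi al x | al in power (strategies A B)].

(* sup over feedback controls b of E[J(X, al[b], b)] *)
Definition worst_mean_cost (B : set 'rV[R]_nB)
    (F : state -> 'rV[R]_nA -> 'rV[R]_nB -> state) (g phi : state -> R)
    dT (T : measurableType dT) (P : probability T R) (X : T -> state)
    (al : N.-tuple strategy) : \bar R :=
  ereal_sup [set ('E_P[fun w => cost F g phi al b (X w)])%E
            | b in power (controls B)].

End game.

Arguments strategies {R d nA nB} A B.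
Arguments controls {R d nB} B.
Arguments power N {T} S.

(* Main.v *)
Require Import Defs.
From HB Require Import structures.
From mathcomp Require Import all_boot all_order all_algebra.
From mathcomp Require Import all_classical all_reals all_analysis.
From mathcomp Require Import measurable_realfun lra.

Import Order.TTheory GRing.Theory Num.Theory.
Import numFieldNormedType.Exports.
Local Open Scope classical_set_scope.
Local Open Scope ring_scope.

Set Implicit Arguments.
Unset Strict Implicit.
Unset Printing Implicit Defensive.

(* Dynamic programming: with W_0 = phi and
     W_(n+1)(x) = g(x) \/ max_b min_a W_n(F(x, a, b)),
   every W_n is continuous, and measurable selection yields a feedback strategy
   a^ and a feedback control b^ for which the Bellman equation holds with
   equality.  Hence J(x, a^[b], b) <= W_N(x) <= J(x, al[b^], b^) pointwise for
   all b and al, so W_N is the value and, integrals being monotone, both sides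
   of (i) equal E[W_N(X)].

   For (ii), let al be optimal in mean and suppose that its worst cost exceeds
   W_N on a set not negligible for the law of X.  For some rational q, the states
   x with W_N(x) < q from which some open-loop control makes the cost exceed q
   form a non-negligible set.  It is the projection of a Borel set, hence Suslin,
   so by capacitability it carries a measurable choice of open-loop controls on
   a set of positive measure.  Pushing the law forward along the first move and
   recursing turns this choice into a feedback control b, which reverts to b^
   whenever W_n > q or exceeding q is not guaranteed.  Then J(., al[b], b) is
   >= W_N everywhere and > W_N with positive probability, contradicting the
   optimality of al since W_N(X) is integrable. *)

(** * Suslin sets and capacitability *)

(* Instead of being indexed by the finite sequence s|k, the closed set D k s
   depends on s through finitely many coordinates. *)
Definition suslin {Y : topologicalType} (E : set Y) :=
  exists D : nat -> (nat -> nat) -> set Y,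
    [/\ forall k s, closed (D k s),
        forall k s, exists m, forall t,
          (forall i, (i < m)%N -> t i = s i) -> D k t = D k s
      & E = \bigcup_s \bigcap_k D k s].

Section suslin.
Context {Y : topologicalType}.
Implicit Types E : set Y.

Lemma suslin_closed E : closed E -> suslin E.
Proof.
move=> cE; exists (fun _ _ => E); split => //; first by move=> *; exists 0%N.
by apply/seteqP; split=> [x Ex|x [s _ /(_ 0%N I)]//]; exists (fun=> 0%N).
Qed.

(** The first term of the index picks a member of the union; the shifted sequence indexes its
    scheme. *)
Lemma suslin_bigcup (E : nat -> set Y) :
  (forall i, suslin (E i)) -> suslin (\bigcup_i E i).
Proof.
move=> /choice[D HD].
exists (fun k s => D (s 0%N) k (fun n => s n.+1)); split.
- by move=> k s; case: (HD (s 0%N)).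
- move=> k s; case: (HD (s 0%N)) => _ /(_ k (fun n => s n.+1))[m Hm] _.
  exists m.+1 => t ts; rewrite ts//; apply: Hm => i im; exact: ts.
- apply/seteqP; split=> [x [i _]|x [s _ Hs]].
    have [_ _ ->] := HD i => -[s _ Hs].
    by exists (fun n => if n is n'.+1 then s n' else i).
  exists (s 0%N) => //; have [_ _ ->] := HD (s 0%N).
  by exists (fun n => s n.+1).
Qed.

(** One sequence carries countably many indices, the [i]-th being stored at the positions
    [pickle (i, n)]. *)
Lemma suslin_bigcap (E : nat -> set Y) :
  (forall i, suslin (E i)) -> suslin (\bigcap_i E i).
Proof.
move=> /choice[D HD].
pose row (i : nat) (s : nat -> nat) (n : nat) := s (pickle (i, n)).
exists (fun k s => if unpickle k is Some (i, j) then D i j (row i s) else setT).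
split.
- move=> k s; case: unpickle => [[i j]|]; last exact: closedT.
  by case: (HD i).
- move=> k s; case: unpickle => [[i j]|]; last by exists 0%N.
  have [_ /(_ j (row i s))[m Hm] _] := HD i.
  exists (\max_(n < m) pickle (i, n : nat)).+1 => t ts.
  apply: Hm => n nm; apply: ts; rewrite ltnS.
  exact: (@leq_bigmax _ (fun n : 'I_m => pickle (i, n : nat)) (Ordinal nm)).
- apply/seteqP; split=> [x Ex|x [s _ Hs] i _].
    have /choice[s Hs] : forall i, exists s, forall k, D i k s x.
      move=> i; have := Ex i I; have [_ _ ->] := HD i => -[s _ Hs].
      by exists s => k; exact: Hs.
    exists (fun k => if unpickle k is Some (i, n) then s i n else 0%N) => // k _.
    case: unpickle => [[i j]|] //.
    by rewrite /row; under eq_fun do rewrite pickleK; exact: Hs.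
  have [_ _ ->] := HD i; exists (row i s) => // j _.
  by have := Hs (pickle (i, j)) I; rewrite pickleK.
Qed.

End suslin.

Lemma suslin_preimage (Y Z : topologicalType) (f : Y -> Z) (E : set Z) :
  continuous f -> suslin E -> suslin (f @^-1` E).
Proof.
move=> cf [D [cD mD ->]]; exists (fun k s => f @^-1` D k s); split.
- by move=> k s; move/continuous_closedP : cf; apply; exact: cD.
- by move=> k s; have [m Hm] := mD k s; exists m => t /Hm ->.
- by rewrite preimage_bigcup; apply: eq_bigcupr => s _; rewrite preimage_bigcap.
Qed.

(** Open sets are countable unions of closed ones: [C n] keeps the points outside the interiors of
    all balls of radius 1/(n+1) centred in the complement. *)
Lemma suslin_open (R : realType) (Y : pseudoMetricType R) (U : set Y) :
  open U -> suslin U.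
Proof.
move=> oU; pose C n := ~` \bigcup_(z in ~` U) (ball z n.+1%:R^-1)^°.
rewrite (_ : U = \bigcup_n C n).
  apply: suslin_bigcup => n; apply: suslin_closed; apply: open_closedC.
  by apply: bigcup_open => z _; exact: open_interior.
apply/seteqP; split=> [x Ux|x [n _ Cx]]; last first.
  apply: contrapT => nUx; apply: Cx; exists x => //.
  by apply: nbhsx_ballx; rewrite invr_gt0.
have /nbhs_ballP[e /= e0 eU] : nbhs x U by exact: open_nbhs_nbhs.
exists (Num.truncn e^-1) => // -[z nUz /interior_subset zx]; apply: nUz.
apply: eU; apply: ball_sym; apply: le_ball zx.
by rewrite invf_ple ?posrE// ltW// truncnS_gt.
Qed.

(** Suslin sets need not be stable under complement; imposing the property on the complement as well
    restores stability, so Borel sets can be reached from generators. *)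
Lemma bisuslin_sigma_algebra (Y : topologicalType) :
  sigma_algebra [set: Y] [set E | suslin E /\ suslin (~` E)].
Proof.
split=> [|E [sE sCE]|E sE] /=.
- by rewrite setC0; split; apply: suslin_closed; [exact: closed0|exact: closedT].
- by rewrite setTD setCK.
- split; first by apply: suslin_bigcup => i; case: (sE i).
  by rewrite setC_bigcup; apply: suslin_bigcap => i; case: (sE i).
Qed.

Lemma measurable_mx_bisuslin (R : realType) (m n : nat) (E : set 'M[R]_(m, n)) :
  measurable E -> suslin E /\ suslin (~` E).
Proof.
apply: (smallest_sub (@bisuslin_sigma_algebra _)) => U oU; split; first exact: suslin_open.
by apply: suslin_closed; exact: open_closedC.
Qed.

Lemma measurable_prod_suslin (R : realType) (m n p q : nat)
  (E : set ('M[R]_(m, n) * 'M[R]_(p, q))) : measurable E -> suslin E.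
Proof.
move=> mE; suff [] : suslin E /\ suslin (~` E) by [].
have H (r s : nat) (f : 'M[R]_(m, n) * 'M[R]_(p, q) -> 'M[R]_(r, s))
    (C : set 'M[R]_(r, s)) : continuous f -> measurable C ->
    suslin (setT `&` f @^-1` C) /\ suslin (~` (setT `&` f @^-1` C)).
  move=> cf /measurable_mx_bisuslin[sC sCC]; rewrite setTI.
  by split; [exact: suslin_preimage|rewrite preimage_setC; exact: suslin_preimage].
apply: (smallest_sub (@bisuslin_sigma_algebra _)) mE => _ [] [C mC <-].
- by apply: H mC => x; exact: cvg_fst.
- by apply: H mC => x; exact: cvg_snd.
Qed.

(** * Outer measure through measurable covers *)

Section outer_small.
Context d (T : measurableType d) (R : realType) (mu : {measure set T -> \bar R}).
Local Open Scope ereal_scope.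

Definition outer_le (t : R) (S : set T) :=
  exists M, [/\ measurable M, S `<=` M & mu M <= t%:E].

(** Continuity from below of the outer measure. Intersecting the tails of the covers makes them
    increase, and [H n] still covers [S n] because [S] is increasing. *)
Lemma outer_le_bigcup t (S : nat -> set T) :
  {homo S : n m / (n <= m)%N >-> n `<=` m} ->
  (forall n, outer_le t (S n)) -> outer_le t (\bigcup_n S n).
Proof.
move=> ndS /choice[M HM].
pose H n := \bigcap_(m in [set m | (n <= m)%N]) M m.
have mH n : measurable (H n).
  by apply: bigcap_measurable => [|m _]; [exists n => /=|case: (HM m)].
have SH n : S n `<=` H n.
  by move=> x Sx m /= nm; have [_ + _] := HM m; apply; exact: (ndS _ _ nm).
exists (\bigcup_n H n); split; first exact: bigcup_measurable.
  by move=> x [n _ /SH]; exists n.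
have ndH : {homo H : n m / (n <= m)%N >-> (n <= m)%O}.
  by move=> n m nm; apply/subsetPset => x Hx k /= /(leq_trans nm); exact: Hx.
have cvgH := @nondecreasing_cvg_mu _ _ _ mu _ mH (bigcup_measurable (fun n _ => mH n)) ndH.
rewrite -(cvg_lim _ cvgH)//; apply: lime_le; first by apply/cvg_ex; eexists; exact: cvgH.
near=> n; have [mM _ /=] := HM n; apply: le_trans; rewrite le_measure ?inE//.
by move=> x; apply => /=.
Unshelve. all: by end_near. Qed.

Lemma negligible_outer_le (S : set T) :
  (forall t, (0 < t)%R -> outer_le t S) -> mu.-negligible S.
Proof.
move=> HS; have /choice[M HM] n : outer_le n.+1%:R^-1 S by exact: HS.
have mM n : measurable (M n) by case: (HM n).
exists (\bigcap_n M n); split; first exact: bigcap_measurable.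
  apply/eqP; rewrite eq_le measure_ge0 andbT; apply/lee_addgt0Pr => e e0.
  pose n := Num.truncn e^-1; have [_ _ Mn] := HM n.
  rewrite add0e (@le_trans _ _ (mu (M n)))//.
    by rewrite le_measure ?inE//; [exact: bigcap_measurable|move=> x; exact].
  rewrite (le_trans Mn)//.
  by rewrite lee_fin invf_ple ?posrE// ltW// truncnS_gt.
by move=> x Sx n _; have [_ + _] := HM n; exact.
Qed.

End outer_small.

(* Koenig's lemma, run along an ultrafilter. *)
Lemma ultra_suslin_limit (Y : topologicalType) (D : nat -> (nat -> nat) -> set Y)
    (I : Type) (G : set_system I) (u : I -> Y) (s : I -> nat -> nat)
    (n : nat -> nat) (y : Y) :
  (forall k s, closed (D k s)) ->
  (forall k s, exists m, forall t,
     (forall i, (i < m)%N -> t i = s i) -> D k t = D k s) ->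
  UltraFilter G -> u @ G --> y ->
  (forall i, \forall j \near G, (s j i <= n i)%N) ->
  (\forall j \near G, forall k, D k (s j) (u j)) ->
  exists c, (forall i, (c i <= n i)%N) /\ forall k, D k c y.
Proof.
move=> cD mD UG uy sn sD.
have PG : ProperFilter G by exact: ultra_proper.
(* A coordinate bounded by [n i] has finitely many possible values, so it is eventually constant
   along the ultrafilter; these constants form the limit index [c]. *)
have /choice[c Hc] i : exists c, (c <= n i)%N /\ \forall j \near G, s j i = c.
  apply: contrapT => /forallNP nc.
  have h m : (m <= (n i).+1)%N ->
      \forall j \near G, forall c, (c < m)%N -> s j i <> c.
    elim: m => [_|m IH mn]; first by near=> j.
    have h : \forall j \near G, s j i <> m.
      have [G1|//] := in_ultra_setVsetC [set j | s j i = m] UG.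
      by case: (nc m); split; [exact: mn|exact: G1].
    have := IH (ltnW mn); apply: filterS2 h => j jm IHj c.
    by rewrite ltnS leq_eqVlt => /orP[/eqP ->//|]; exact: IHj.
  have [j [h1 h2]] := filter_ex (filterI (h _ (leqnn _)) (sn i)).
  exact: (h1 (s j i)).
exists c; split=> [i|k]; first by case: (Hc i).
(* [D k c] depends on finitely many coordinates of [c], on which [s j] eventually agrees with [c];
   closedness then passes to the limit. *)
have [m Hm] := mD k c.
apply: (@closed_cvg _ _ _ PG u (D k c)) => //.
have : \forall j \near G, forall i, (i < m)%N -> s j i = c i.
  elim: {Hm}m => [|m IH]; first by near=> j.
  have [_ h] := Hc m; apply: filterS2 IH h => j IHj jm i.
  by rewrite ltnS leq_eqVlt => /orP[/eqP ->//|]; exact: IHj.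
by apply: filterS2 sD => j sDj /Hm <-.
Unshelve. all: by end_near. Qed.

Lemma ultra_compact_cvg (Y : topologicalType) (Q : set Y)
    (I : Type) (G : set_system I) (u : I -> Y) :
  compact Q -> UltraFilter G -> (\forall j \near G, Q (u j)) ->
  exists2 y, Q y & u @ G --> y.
Proof.
move=> cQ UG Qu; have PG : ProperFilter G by exact: ultra_proper.
have [y [Qy cy]] := cQ (u @ G) _ Qu; exists y => // A yA.
have [//|GC] := in_ultra_setVsetC (u @^-1` A) UG.
by have [z [nAz Az]] := cy (~` A) A GC yA.
Qed.

(* Choquet's capacitability theorem for the outer measure of mu. *)
Theorem suslin_compact_approx (R : realType) (d : nat) (Y : topologicalType)
    (mu : {measure set 'rV[R]_d -> \bar R})
    (Q : nat -> set Y) (p : Y -> 'rV[R]_d) (E : set Y) :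
  (mu setT < +oo)%E -> (forall n, compact (Q n)) -> {homo Q : n m / (n <= m)%N >-> n `<=` m} ->
  \bigcup_n Q n = setT -> continuous p -> suslin E ->
  ~ mu.-negligible (p @` E) ->
  exists K, [/\ compact K, K `<=` E & (0 < mu (p @` K))%E].
Proof.
move=> mufin cQ ndQ QT cp [D [cD mD ED]] nE.
(* All the choices below keep the outer measure of the projection above this [t]. *)
have [t t0 tE] : exists2 t, (0 < t)%R & ~ outer_le mu t (p @` E).
  apply: contrapT => /forall2NP H; apply: nE; apply: negligible_outer_le => t t0.
  by have [//|/contrapT] := H t.
pose S M (l : seq nat) := [set y | Q M y /\ exists s,
  (forall i, (i < size l)%N -> (s i <= nth 0 l i)%N) /\ forall k, D k s y].
have [M tM] : exists M, ~ outer_le mu t (p @` S M [::]).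
  apply: contrapT => /forallNP H; apply: tE.
  rewrite (_ : p @` E = \bigcup_M (p @` S M [::])).
    apply: outer_le_bigcup => [n m nm|M]; last exact: contrapT (H M).
    by move=> _ [y [Qy Hy] <-]; exists y => //; split=> //; exact: ndQ Qy.
  rewrite -image_bigcup ED; congr (_ @` _); apply/seteqP; split=> y.
    move=> [s _ sy]; have [M _ QM] : (\bigcup_n Q n) y by rewrite QT.
    by exists M => //; split=> //; exists s; split=> // k; exact: sy.
  by move=> [M' _ [_ [s [_ sy]]]]; exists s.
(* [S M l] is the increasing union over [n] of [S M (rcons l n)], so by continuity from below one
   more coordinate can be bounded without falling to [t]. *)
have /choice[next Hnext] l : exists n, ~ outer_le mu t (p @` S M l) ->
    ~ outer_le mu t (p @` S M (rcons l n)).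
  apply: contrapT => /forallNP H.
  have /not_implyP[nS _] := H 0%N.
  apply: nS; rewrite (_ : p @` S M l = \bigcup_n (p @` S M (rcons l n))).
    apply: outer_le_bigcup => [n m nm|n]; last first.
      by have /not_implyP[_ /contrapT] := H n.
    move=> _ [y [Qy [s [sl Hs]]] <-]; exists y => //; split=> //; exists s.
    split=> // i; move: (sl i); rewrite !size_rcons !nth_rcons.
    by case: (ltngtP i (size l)) => // _ h il; exact: leq_trans (h il) nm.
  rewrite -image_bigcup; congr (_ @` _); apply/seteqP; split=> y.
    move=> [Qy [s [sl Hs]]]; exists (s (size l)) => //; split=> //; exists s.
    split=> // i; rewrite size_rcons nth_rcons ltnS.
    by case: (ltngtP i (size l)) => // [il _|-> _//]; exact: sl.
  move=> [n _ [Qy [s [sl Hs]]]]; split=> //; exists s; split=> // i il.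
  by have := sl i; rewrite size_rcons nth_rcons il => /(_ (ltnW il)).
pose L := fix L k := if k is k'.+1 then rcons (L k') (next (L k')) else [::].
have tL k : ~ outer_le mu t (p @` S M (L k)) by elim: k => //= k; exact: Hnext.
have sL k : size (L k) = k by elim: k => //= k IH; rewrite size_rcons IH.
pose n i := next (L i).
have nL k i : (i < k)%N -> nth 0%N (L k) i = n i.
  elim: k => //= k IH; rewrite ltnS nth_rcons sL.
  by case: (ltngtP i k) => // [ik _|-> _]; [exact: IH|].
(* All coordinates are now bounded at once; a limit of points of [K] keeps a bounded index by
   [ultra_suslin_limit]. *)
pose K := [set y | Q M y /\ exists s,
  (forall i, (s i <= n i)%N) /\ forall k, D k s y].
have cK : compact K.
  rewrite compact_ultra => G UG GK.
  have PG : ProperFilter G by exact: ultra_proper.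
  have [|y Qy Gy] := @ultra_compact_cvg _ _ _ _ id (cQ M) UG.
    by apply: filterS GK => y [].
  have /choice[s Hs] y' : exists s, K y' ->
      (forall i, (s i <= n i)%N) /\ forall k, D k s y'.
    have [[_ [s Hs]]|nK] := pselect (K y'); first by exists s.
    by exists (fun=> 0%N).
  exists y; split=> //; split=> //.
  by apply: (@ultra_suslin_limit _ D _ G id s) => //;
    [move=> i|]; apply: filterS GK => y' /Hs[].
have KE : K `<=` E by move=> y [_ [s [_ Hs]]]; rewrite ED; exists s.
exists K; split=> //.
(* Otherwise each [S M (L k)] has a point projecting outside [U]; a limit of these along an
   ultrafilter lies in [K] and still projects outside [U]. *)
have nearK (U : set 'rV[R]_d) : open U -> p @` K `<=` U ->
    exists k, p @` S M (L k) `<=` U.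
  move=> oU KU; apply: contrapT => /forallNP H.
  have /choice[y Hy] k : exists y, S M (L k) y /\ ~ U (p y).
    by have /existsNP[_ /not_implyP[[y Sy <-] nU]] := H k; exists y.
  have /choice[s Hs] k : exists s,
      (forall i, (i < k)%N -> (s i <= n i)%N) /\ forall j, D j s (y k).
    have [[_ [s [sl Hs]]] _] := Hy k; exists s; split=> // i ik.
    by have := sl i; rewrite sL nL//; exact.
  have [G [UG ooG]] := @ultraFilterLemma _ \oo _.
  have PG : ProperFilter G by exact: ultra_proper.
  have [|z Qz yz] := @ultra_compact_cvg _ _ _ _ y (cQ M) UG.
    by apply: ooG; exists 0%N => // k _ /=; have [[]] := Hy k.
  have nUz : ~ U (p z).
    apply: (@closed_cvg _ _ _ PG y (p @^-1` (~` U))) yz.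
      by move/continuous_closedP : cp; apply; exact: open_closedC.
    by apply: ooG; exists 0%N => // k _ /=; case: (Hy k).
  apply: nUz; apply: KU; exists z => //; split => //.
  apply: (@ultra_suslin_limit _ D _ G y s) => //.
    move=> i; apply: ooG; exists i.+1 => // k /= ik.
    by have [+ _] := Hs k; exact.
  by apply: ooG; exists 0%N => // k _ /=; case: (Hs k).
have cpK : compact (p @` K).
  by apply: continuous_compact => //; exact: continuous_subspaceT.
have clpK : closed (p @` K) by apply: compact_closed => //; exact: norm_hausdorff.
pose U m := \bigcup_(x in p @` K) (ball x m.+1%:R^-1)^°.
have oU m : open (U m) by apply: bigcup_open => x _; exact: open_interior.
have mU m : measurable (U m) by exact: open_measurable_mx.
have UK : \bigcap_m U m = p @` K.
  apply/seteqP; split=> [x Ux|x Kx m _]; last first.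
    by exists x => //; apply: nbhsx_ballx; rewrite invr_gt0.
  apply: clpK => B /nbhs_ballP[e /= e0 eB].
  have [z Kz /interior_subset zx] := Ux (Num.truncn e^-1) I.
  exists z; split=> //; apply: eB; apply: ball_sym; apply: le_ball zx.
  by rewrite invf_ple ?posrE// ltW// truncnS_gt.
have ndU : {homo U : n m / (n <= m)%N >-> (m <= n)%O}.
  move=> i j ij; apply/subsetPset => x [z Kz zx]; exists z => //.
  apply: interiorS zx; apply: le_ball.
  by rewrite lef_pV2 ?posrE// ler_nat ltnS.
apply: (@lt_le_trans _ _ t%:E); first by rewrite lte_fin.
rewrite -UK.
have cvgU := @nonincreasing_cvg_mu _ _ _ mu _ _ mU _ ndU.
have U0 : (mu (U 0%N) < +oo)%E.
  by apply: le_lt_trans mufin; rewrite le_measure ?inE.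
rewrite -(cvg_lim _ (cvgU U0 _))//; last exact: bigcap_measurable.
apply: lime_ge.
  by apply/cvg_ex; eexists; apply: cvgU => //; exact: bigcap_measurable.
(* If [mu (U m)] were below [t], then [U m] would be a forbidden cover of the projection of some
   [S M (L k)]. *)
apply: nearW => m; rewrite leNgt; apply/negP => Um.
have [k Sk] : exists k, p @` S M (L k) `<=` U m.
  by apply: nearK => //; rewrite -UK => x; exact.
by apply: (tL k); exists (U m); split=> //; exact: ltW.
Qed.

(** * Measurable selection *)

Section selection.
Context dX (X : measurableType dX) (R : realType).

(** Testing with closed rather than open sets allows cutting the values by closed sublevel sets. *)
Definition measurable_multi {Z : topologicalType} (Gam : X -> set Z) :=
  (forall x, compact (Gam x)) /\
  forall C, closed C -> measurable [set x | Gam x `&` C !=set0].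

Definition argmin {Z : Type} (G : set Z) (h : Z -> R) :=
  G `&` [set z | forall z', G z' -> h z <= h z'].

(** The sets [F q] are nested, closed and non-empty in the compact [G], so they share a point, which
    is minimal because rational levels are dense. Testing rational levels only keeps the criterion
    countable. *)
Lemma compact_argmin (Z : topologicalType) (G C : set Z) (h : Z -> R) :
  compact G -> (forall r, closed (G `&` [set z | h z <= r])) -> closed C ->
  G !=set0 ->
  (forall q : rat, G `&` [set z | h z <= ratr q] !=set0 ->
     G `&` C `&` [set z | h z <= ratr q] !=set0) ->
  argmin G h `&` C !=set0.
Proof.
move=> cG ch cC [z0 Gz0] H.
pose I := [set q : rat | G `&` [set z | h z <= ratr q] !=set0].
pose F q := G `&` C `&` [set z | h z <= ratr q].
have Iup z : G z -> forall r, h z < r -> exists2 q, I q & ratr q < r.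
  move=> Gz r zr; have [q] := rat_in_itvoo zr.
  rewrite in_itv/= => /andP[zq qr].
  by exists q => //; exists z; split=> //; exact: ltW.
have [|q0 Iq0 _] := Iup _ Gz0 (h z0 + 1); first by rewrite ltrDl.
have FF : ProperFilter (filter_from I F).
  apply: filter_from_proper => [|q Iq]; last exact: H.
  apply: filter_from_filter; first by exists q0.
  move=> p q Ip Iq; have [pq|/ltW qp] := leP p q.
    exists p => // z [GC zp]; do 2 split=> //.
    by apply: le_trans zp _; rewrite ler_rat.
  exists q => // z [GC zp]; do 2 split=> //.
  by apply: le_trans zp _; rewrite ler_rat.
have [|z [Gz clz]] := cG (filter_from I F).
  by exists q0 => // z [[]].
have Fz q : I q -> F q z.
  move=> Iq; have cF : closed (F q).
    rewrite (_ : F q = G `&` [set z | h z <= ratr q] `&` C).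
      exact: closedI.
    by rewrite /F -!setIA (setIC C).
  by apply: cF => B zB; apply: clz => //; exists q.
exists z; split; last by have [[]] := Fz _ Iq0.
split=> // z' Gz'; rewrite leNgt; apply/negP => zz'.
have [q Iq qz] := Iup _ Gz' _ zz'.
by have [_ /=] := Fz _ Iq; rewrite leNgt qz.
Qed.

Lemma measurable_multi_argmin (Z : topologicalType) (Gam : X -> set Z)
    (h : X -> Z -> R) :
  hausdorff_space Z -> measurable_multi Gam ->
  (forall x r, closed (Gam x `&` [set z | h x z <= r])) ->
  (forall C r, closed C ->
     measurable [set x | Gam x `&` C `&` [set z | h x z <= r] !=set0]) ->
  measurable_multi (fun x => argmin (Gam x) (h x)) /\
  forall x, Gam x !=set0 -> argmin (Gam x) (h x) !=set0.
Proof.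
move=> hZ [cG mG] ch mh; split; last first.
  move=> x Gx; have [|z [Hz _]] := compact_argmin (cG x) (ch x) closedT Gx.
    by move=> q; rewrite setIT.
  by exists z.
split=> [x|C cC].
  apply: (subclosed_compact _ (cG x)) => [|z []//].
  rewrite (_ : argmin _ _ = Gam x `&`
      \bigcap_(z' in Gam x) (Gam x `&` [set z | h x z <= h x z'])).
    apply: closedI; first exact: compact_closed.
    by apply: closed_bigI => z' _; exact: ch.
  apply/seteqP; split=> z [Gz Hz]; split=> // z' Gz'; last by case: (Hz _ Gz').
  by split=> //; exact: Hz.
(* [A q] encodes the implication required by [compact_argmin] at level [q]. *)
pose A q := ~` [set x | Gam x `&` setT `&` [set z | h x z <= ratr q] !=set0] `|`
  [set x | Gam x `&` C `&` [set z | h x z <= ratr q] !=set0].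
rewrite (_ : mkset _ = [set x | Gam x `&` setT !=set0] `&`
    ~` \bigcup_(q : rat) ~` A q).
  apply: measurableI; first by apply: mG; exact: closedT.
  apply: measurableC; apply: countable_bigcupT_measurable => [|q].
    exact: countableP.
  apply: measurableC; apply: measurableU; last exact: mh.
  by apply: measurableC; apply: mh; exact: closedT.
apply/seteqP; split=> x /=.
  move=> [z [[Gz Hz] Cz]]; split; first by exists z.
  move=> [q _]; apply; rewrite /A /=.
  have [[z' [[Gz' _] z'q]]|] :=
    pselect (Gam x `&` setT `&` [set z | h x z <= ratr q] !=set0); last by left.
  by right; exists z; split=> //=; exact: le_trans (Hz _ Gz') z'q.
move=> [Gx HA]; apply: compact_argmin => //; first by rewrite setIT in Gx.
move=> q Hq; apply: contrapT => nH; apply: HA; exists q => //.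
by rewrite /A /= setIT => -[].
Qed.

(* Minimizing finitely many separating functions one after the other leaves a
   single point, the lexicographic minimum. *)
Lemma measurable_multi_lex (Z : topologicalType) (Gam : X -> set Z)
    (I : eqType) (h : I -> Z -> R) (l : seq I) :
  hausdorff_space Z -> (forall i, continuous (h i)) -> measurable_multi Gam ->
  exists Gam', [/\ measurable_multi Gam', forall x, Gam' x `<=` Gam x,
    forall x, Gam x !=set0 -> Gam' x !=set0 &
    forall x z z', Gam' x z -> Gam' x z' -> {in l, forall i, h i z = h i z'}].
Proof.
move=> hZ ch; elim: l Gam => [|i l IH] Gam; first by move=> mG; exists Gam; split=> // x z; exact.
move=> [cG mG].
have ch' r : closed [set z | h i z <= r].
  by have /continuous_closedP := ch i => /(_ _ (@closed_le _ r)).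
have [||mG' G'0] := @measurable_multi_argmin _ Gam (fun=> h i) hZ (conj cG mG).
- by move=> x r; apply: closedI => //; exact: compact_closed.
- move=> C r cC; under eq_set do rewrite -setIA.
  by apply: mG; exact: closedI.
have [Gam' [mG2 sG2 G20 uG2]] := IH _ mG'.
exists Gam'; split=> //.
- by move=> x z /sG2[].
- by move=> x /G'0/G20.
- move=> x z z' G2z G2z' j; rewrite inE => /orP[/eqP ->|]; last exact: (uG2 _ _ _ G2z G2z').
  have [Gz Hz] := sG2 _ _ G2z; have [Gz' Hz'] := sG2 _ _ G2z'.
  by apply/eqP; rewrite eq_le Hz// Hz'.
Qed.

Lemma measurable_selection (m : nat) (Gam : X -> set 'rV[R]_m) :
  measurable_multi Gam ->
  exists s : X -> 'rV[R]_m, measurable_fun setT s /\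
    forall x, Gam x !=set0 -> Gam x (s x).
Proof.
move=> mG.
have [|Gam' [[cG' mG'] sG G0 uG]] := @measurable_multi_lex _ Gam 'I_m
    (fun i z => z ord0 i) (enum 'I_m) (@norm_hausdorff _ _) _ mG.
  by move=> i; exact: coord_continuous.
have {}uG x z z' : Gam' x z -> Gam' x z' -> z = z'.
  move=> Gz Gz'; apply/rowP => i; apply: (uG x z z' Gz Gz').
  by rewrite mem_enum.
have /choice[s Hs] x : exists z, if `[< Gam' x !=set0 >] then Gam' x z else z = 0.
  by case: asboolP => [[z Gz]|_]; [exists z|exists 0].
exists s; split=> [|x /G0 Gx]; last first.
  by apply: sG; have := Hs x; case: asboolP.
apply: (@measurability _ _ _ _ _ _ (@open 'rV[R]_m)) => // _ [U oU <-].
rewrite setTI -[U]setCK -preimage_setC; apply: measurableC.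
(* Where [Gam' x] is a single point, [s x] avoids [U] exactly when [Gam' x] meets the complement;
   the second piece handles the default [0] over empty values. *)
rewrite (_ : _ @^-1` _ = [set x | Gam' x `&` ~` U !=set0] `|`
    (~` [set x | Gam' x `&` setT !=set0] `&` [set x | (~` U) 0])).
  apply: measurableU; first by apply: mG'; exact: open_closedC.
  apply: measurableI; first by apply: measurableC; apply: mG'; exact: closedT.
  have [U0|nU0] := pselect ((~` U) 0).
    by rewrite (_ : mkset _ = setT)//; apply/seteqP; split.
  by rewrite (_ : mkset _ = set0)//; apply/seteqP; split.
apply/seteqP; split=> x /=.
  have := Hs x; rewrite setIT; case: asboolP => [_ Gs nUs|nG ->]; last by right.
  by left; exists (s x).
rewrite setIT; have := Hs x; case: asboolP => [Gx Gs|nG ->].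
  by move=> [[z [Gz nUz]]|[]//]; rewrite (uG _ _ _ Gs Gz).
by move=> [[z [Gz _]]|[]//]; case: nG; exists z.
Qed.

End selection.

(** * Minima over compact sets and their continuity *)

Section compact_minimum.
Context {X Z : topologicalType}.

(** Witnesses over points approaching [x] converge in [A] along an ultrafilter: projection along a
    compact factor is a closed map. *)
Lemma closed_exists_compact (A : set Z) (C : set (X * Z)) :
  compact A -> closed C -> closed [set x | exists2 z, A z & C (x, z)].
Proof.
move=> cA cC x clx; pose S := [set x | exists2 z, A z & C (x, z)].
have PF : ProperFilter (within S (nbhs x)) := within_nbhs_proper clx.
have [z0 _] : A !=set0 by have [_ [[z Az _] _]] := clx _ (@filterT _ _ _); exists z.
have /choice[f Hf] x' : exists z, S x' -> A z /\ C (x', z).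
  have [[z Az Cz]|nS] := pselect (S x'); first by exists z.
  by exists z0.
have [G [UG FG]] := @ultraFilterLemma _ _ PF.
have PG : ProperFilter G by exact: ultra_proper.
have GS : \forall x' \near G, S x' by apply: FG; exact: withinT.
have [|z Az Gz] := @ultra_compact_cvg _ _ _ _ f cA UG.
  by apply: filterS GS => x' /Hf[].
exists z => //; apply: (@closed_cvg _ _ _ PG (fun x' => (x', f x')) C) => //.
  by apply: filterS GS => x' /Hf[].
apply: cvg_pair => //= B xB; apply: FG.
by apply: (@filterS _ _ _ B) xB => y By _.
Qed.

Lemma closed_ysection (C : set (X * Z)) z : closed C -> closed [set x | C (x, z)].
Proof.
move=> cC; have cz : continuous (fun x : X => (x, z)).
  by move=> x; apply: cvg_pair => //; exact: cvg_cst.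
by move/continuous_closedP : cz => /(_ _ cC).
Qed.

Lemma closed_xsection (C : set (X * Z)) x : closed C -> closed [set z | C (x, z)].
Proof.
move=> cC; have cx : continuous (fun z : Z => (x, z)).
  by move=> z; apply: cvg_pair; [exact: cvg_cst|exact: cvg_id].
by move/continuous_closedP : cx => /(_ _ cC).
Qed.

End compact_minimum.

(* For closed D, this is the continuity of h on D. *)
Definition clevel {R : realType} {X : topologicalType} (D : set X) (h : X -> R) :=
  forall r, closed (D `&` [set x | h x <= r]) /\ closed (D `&` [set x | r <= h x]).

(** Berge's theorem: a sublevel set of the minimum is a projection along the compact [A], a
    superlevel set is an intersection of sections. *)
Lemma clevel_min {R : realType} {X Z : topologicalType} (D : set X) (A : set Z)
    (h : X * Z -> R) (m : X -> R) :
  closed D -> compact A -> clevel (D `*` A) h ->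
  (forall x, D x -> (exists2 a, A a & m x = h (x, a)) /\
                    forall a, A a -> m x <= h (x, a)) ->
  clevel D m.
Proof.
move=> cD cA ch Hm r; split.
  rewrite (_ : _ `&` _ = [set x | exists2 a, A a &
      (D `*` A `&` [set p | h p <= r]) (x, a)]).
    by apply: closed_exists_compact => //; case: (ch r).
  apply/seteqP; split=> x /=.
    by move=> [Dx mr]; have [[a Aa ma] _] := Hm _ Dx; exists a; rewrite // -ma.
  move=> [a Aa [[Dx _] hr]]; split=> //.
  by have [_ H] := Hm _ Dx; exact: le_trans (H _ Aa) hr.
rewrite (_ : _ `&` _ = D `&` \bigcap_(a in A) [set x |
    (D `*` A `&` [set p | r <= h p]) (x, a)]).
  apply: closedI => //; apply: closed_bigI => a Aa; apply: closed_ysection.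
  by case: (ch r).
apply/seteqP; split=> x /= [Dx Hx]; split=> //.
  by move=> a Aa /=; split=> //; have [_ H] := Hm _ Dx; exact: le_trans (H _ Aa).
by have [[a Aa ->] _] := Hm _ Dx; have [] := Hx _ Aa.
Qed.

Lemma clevelN {R : realType} {X : topologicalType} (D : set X) (h : X -> R) :
  clevel D h -> clevel D (fun x => - h x).
Proof.
move=> ch r; have [h1 h2] := ch (- r); split.
  by under [X in _ `&` X]eq_set do rewrite lerNl.
by under [X in _ `&` X]eq_set do rewrite lerNr.
Qed.

Lemma clevel_max {R : realType} {X : topologicalType} (D : set X) (h k : X -> R) :
  clevel D h -> clevel D k -> clevel D (fun x => Num.max (h x) (k x)).
Proof.
move=> ch ck r; have [h1 h2] := ch r; have [k1 k2] := ck r; split.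
  rewrite (_ : _ `&` _ = (D `&` [set x | h x <= r]) `&` (D `&` [set x | k x <= r])).
    exact: closedI.
  apply/seteqP; split=> x /=; rewrite ge_max.
    by move=> [Dx /andP[]].
  by move=> [[Dx ->] [_ ->]].
rewrite (_ : _ `&` _ = (D `&` [set x | r <= h x]) `|` (D `&` [set x | r <= k x])).
  exact: closedU.
apply/seteqP; split=> x /=; rewrite le_max.
  by move=> [Dx /orP[]]; [left|right].
by move=> [] [Dx ->]; rewrite ?orbT.
Qed.

Lemma clevel_continuous {R : realType} {X : topologicalType} (h : X -> R) :
  continuous h -> clevel setT h.
Proof.
move=> /continuous_closedP ch r; rewrite !setTI.
by split; [exact: (ch _ (@closed_le _ r))|exact: (ch _ (@closed_ge _ r))].
Qed.

(* [i] identifies a measurable structure on [X] finer than its Borel sets. *)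
Lemma measurable_argmin {R : realType} {dX} (X' : measurableType dX)
    (X : topologicalType) (i : X' -> X) (m : nat) (D : set X)
    (A : set 'rV[R]_m) (h : X * 'rV[R]_m -> R) :
  (forall C, closed C -> measurable (i @^-1` C)) ->
  closed D -> compact A -> A !=set0 -> clevel (D `*` A) h ->
  exists s : X' -> 'rV[R]_m, measurable_fun setT s /\
    forall x, D (i x) -> A (s x) /\ forall a, A a -> h (i x, s x) <= h (i x, a).
Proof.
move=> mi cD cA [a0 Aa0] ch; pose Gam x' := [set a | D (i x') /\ A a].
have clA : closed A by apply: compact_closed => //; exact: norm_hausdorff.
have [|||mG' G0] := @measurable_multi_argmin _ X' R _ Gam (fun x' a => h (i x', a))
    (@norm_hausdorff _ _).
- split=> [x'|C cC].
    have [Dx|nDx] := pselect (D (i x')).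
      by rewrite (_ : Gam _ = A)//; apply/seteqP; split=> // a [].
    rewrite (_ : Gam _ = set0); first exact: compact0.
    by apply/seteqP; split=> // a [].
  have [[a [Aa Ca]]|AC] := pselect (A `&` C !=set0).
    rewrite (_ : mkset _ = i @^-1` D); first exact: mi.
    apply/seteqP; split=> x /=; first by move=> [z [[]]].
    by move=> Dx; exists a.
  rewrite (_ : mkset _ = set0)//.
  by apply/seteqP; split=> // x /= [a [[_ Aa] Ca]]; apply: AC; exists a.
- move=> x' r; have [c1 _] := ch r.
  rewrite (_ : _ `&` _ = [set a | (D `*` A `&` [set p | h p <= r]) (i x', a)]).
    exact: closed_xsection.
  by apply/seteqP; split=> a /= [].
(* This hit set comes from the projection of a closed set along the compact intersection of [A] and
   [C]. *)
- move=> C r cC; have [c1 _] := ch r.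
  rewrite (_ : mkset _ = i @^-1` [set x | exists2 a, (A `&` C) a &
      (D `*` A `&` [set p | h p <= r]) (x, a)]).
    apply: mi; apply: closed_exists_compact => //.
    by apply: (subclosed_compact _ cA); [exact: closedI|move=> a []].
  apply/seteqP; split=> x /= [a].
    by move=> [[[Dx Aa] Ca] hr]; exists a.
  by move=> [Aa Ca] [[Dx _] hr]; exists a.
have [s [ms Hs]] := measurable_selection mG'.
exists s; split=> // x Dx; have [|[_ As] Ha] := Hs x.
  by apply: G0; exists a0.
by split=> // a Aa; exact: Ha.
Qed.

(** * The Bellman recursion *)

Lemma continuous_pair (X Y Z : topologicalType) (f : X -> Y) (g : X -> Z) :
  continuous f -> continuous g -> continuous (fun x => (f x, g x)).
Proof. by move=> cf cg x; apply: cvg_pair; [exact: cf|exact: cg]. Qed.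

Lemma closed_setX (X Y : topologicalType) (C : set X) (D : set Y) :
  closed C -> closed D -> closed (C `*` D).
Proof.
move=> cC cD; rewrite (_ : _ `*` _ = fst @^-1` C `&` snd @^-1` D)//.
apply: closedI; apply: closed_comp => // x _; [exact: cvg_fst|exact: cvg_snd].
Qed.

Lemma measurable_fun_pair_on d d1 d2 (T : measurableType d) (T1 : measurableType d1)
    (T2 : measurableType d2) (D : set T) (f : T -> T1) (g : T -> T2) :
  measurable D -> measurable_fun D f -> measurable_fun D g ->
  measurable_fun D (fun x => (f x, g x)).
Proof.
move=> mD /(measurable_restrictT _ mD) mf /(measurable_restrictT _ mD) mg.
apply: (@eq_measurable_fun _ _ _ _ _ (fun x => ((f \_ D) x, (g \_ D) x))).
  by move=> x xD; rewrite !patchE xD.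
by apply: measurable_funTS; exact: measurable_fun_pair.
Qed.

Section borel_closed.
Context {R : realType}.

Lemma closed_measurable_mx m n (C : set 'M[R]_(m, n)) : closed C -> measurable C.
Proof.
by move=> cC; rewrite -[C]setCK; apply: measurableC; apply: open_measurable_mx;
  exact: closed_openC.
Qed.

(** The product carries the product sigma-algebra, not a Borel one by definition; concatenating rows
    transfers the question to Borel sets of a single row space. *)
Lemma closed_measurable_prod m n (C : set ('rV[R]_m * 'rV[R]_n)) :
  closed C -> measurable C.
Proof.
move=> cC; pose j (p : 'rV[R]_m * 'rV[R]_n) := row_mx p.1 p.2.
pose sp (v : 'rV[R]_(m + n)) := (lsubmx v, rsubmx v).
have csp : continuous sp.
  by apply: continuous_pair; [exact: continuous_lsubmx|exact: continuous_rsubmx].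
have mj : measurable_fun setT j.
  apply: measurable_fun_mx => i k; rewrite /j; under eq_fun do rewrite mxE.
  case: (fintype.split k) => l; first exact: measurableT_comp (measurable_coord_mx _ _) measurable_fst.
  exact: measurableT_comp (measurable_coord_mx _ _) measurable_snd.
rewrite (_ : C = setT `&` j @^-1` (sp @^-1` C)).
  apply: mj => //; apply: closed_measurable_mx.
  by move/continuous_closedP : csp => /(_ _ cC).
apply/seteqP; split=> -[x y]; rewrite /= /sp /j/= row_mxKl row_mxKr//.
by move=> [].
Qed.

Lemma closed_measurable_prod3 m n k (C : set ('rV[R]_m * 'rV[R]_n * 'rV[R]_k)) :
  closed C -> measurable C.
Proof.
move=> cC; pose j (p : 'rV[R]_m * 'rV[R]_n * 'rV[R]_k) :=
  (row_mx p.1.1 p.1.2, p.2).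
pose sp (p : 'rV[R]_(m + n) * 'rV[R]_k) := ((lsubmx p.1, rsubmx p.1), p.2).
have csp : continuous sp.
  apply: continuous_pair; last by move=> p; exact: cvg_snd.
  apply: continuous_pair => p; apply: continuous_comp; do ?exact: cvg_fst.
    exact: continuous_lsubmx.
  exact: continuous_rsubmx.
have mj : measurable_fun setT j.
  apply/measurable_fun_pairP; split; last exact: measurable_snd.
  apply: measurable_fun_mx => i l; rewrite /j/=; under eq_fun do rewrite mxE.
  case: (fintype.split l) => q; apply: measurableT_comp (measurable_coord_mx _ _) _.
    exact: measurableT_comp measurable_fst measurable_fst.
  exact: measurableT_comp measurable_snd measurable_fst.
rewrite (_ : C = setT `&` j @^-1` (sp @^-1` C)).
  apply: mj => //; apply: closed_measurable_prod.
  by move/continuous_closedP : csp => /(_ _ cC).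
apply/seteqP; split=> -[[x y] z]; rewrite /= /sp /j/= row_mxKl row_mxKr//.
by move=> [].
Qed.

Lemma measurable_fun_closed dT (T : measurableType dT) m n (D : set T)
    (f : T -> 'M[R]_(m, n)) : measurable D ->
  (forall C, closed C -> measurable (D `&` f @^-1` C)) -> measurable_fun D f.
Proof.
move=> mD mf; apply: (@measurability _ _ _ _ _ _ (@open 'M[R]_(m, n))) => //.
move=> _ [U oU <-].
rewrite (_ : _ `&` _ = D `\` (D `&` f @^-1` (~` U))).
  by apply: measurableD => //; apply: mf; exact: open_closedC.
apply/seteqP; split=> x /= [Dx Ux]; split=> //; first by move=> [].
by apply: contrapT => nUx; apply: Ux.
Qed.

Lemma clevel_measurable dX (X' : measurableType dX) (X : topologicalType)
    (i : X' -> X) (h : X -> R) :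
  (forall C, closed C -> measurable (i @^-1` C)) -> clevel setT h ->
  measurable_fun setT (h \o i).
Proof.
move=> mi ch; apply: (measurability (@RGenCInfty.G R)) => [|_ [_ [r ->] <-]].
  exact: RGenCInfty.measurableE.
rewrite setTI; have [_] := ch r; rewrite setTI => /mi.
by congr measurable; apply/seteqP; split=> x /=; rewrite in_itv/= andbT.
Qed.

End borel_closed.

Section saddle.
Context {R : realType} {d nA nB : nat} {A : set 'rV[R]_nA} {B : set 'rV[R]_nB}.
Context {g phi : 'rV[R]_d -> R} {F : 'rV[R]_d -> 'rV[R]_nA -> 'rV[R]_nB -> 'rV[R]_d}.
Hypotheses (A0 : A !=set0) (cA : compact A) (B0 : B !=set0) (cB : compact B).
Hypotheses (cg : continuous g) (cphi : continuous phi).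
Hypothesis (cF : {within [set: 'rV[R]_d] `*` A `*` B,
  continuous (fun p => F p.1.1 p.1.2 p.2)}).

Let clA : closed A.
Proof. by apply: compact_closed => //; exact: norm_hausdorff. Qed.

Let clB : closed B.
Proof. by apply: compact_closed => //; exact: norm_hausdorff. Qed.

Lemma closed_dynamics C : closed C ->
  closed ([set: 'rV[R]_d] `*` A `*` B `&` (fun p => F p.1.1 p.1.2 p.2) @^-1` C).
Proof.
move=> cC; have cD : closed ([set: 'rV[R]_d] `*` A `*` B).
  by apply: closed_setX => //; apply: closed_setX => //; exact: closedT.
have /continuous_closedP/(_ _ cC)/closed_subspaceP[V cV VE] := cF.
by rewrite setIC -VE; exact: closedI.
Qed.

Lemma measurable_dynamics dT (T : measurableType dT) (D : set T) u v w :
  measurable D -> measurable_fun D u -> measurable_fun D v -> measurable_fun D w ->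
  (forall t, D t -> A (v t) /\ B (w t)) ->
  measurable_fun D (fun t => F (u t) (v t) (w t)).
Proof.
move=> mD mu mv mw vw; apply: measurable_fun_closed => // C cC.
have muvw : measurable_fun D (fun t => ((u t, v t), w t)).
  by do 2 apply: measurable_fun_pair_on => //.
have := muvw mD _ (closed_measurable_prod3 (closed_dynamics cC)).
congr measurable; apply/seteqP; split=> t /= [Dt].
  by move=> [].
by move=> Ct; have [? ?] := vw _ Dt.
Qed.

(** [a] minimizes [V] of the next state jointly measurably in state and opposing control, and [b]
    maximizes the resulting minimum. The maximum with [g x], being monotone, can be taken
    afterwards. *)
Lemma bellman_step (V : 'rV[R]_d -> R) : clevel setT V ->
  exists (W : 'rV[R]_d -> R) a b,
    [/\ clevel setT W, strategies A B a, controls B b,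
        forall x c, B c -> Num.max (g x) (V (F x (a (x, c)) c)) <= W x
      & forall x c, A c -> W x <= Num.max (g x) (V (F x c (b x)))].
Proof.
move=> cV.
pose h1 (p : 'rV[R]_d * 'rV[R]_nB * 'rV[R]_nA) := V (F p.1.1 p.2 p.1.2).
pose sw (p : 'rV[R]_d * 'rV[R]_nB * 'rV[R]_nA) := ((p.1.1, p.2), p.1.2).
have csw : continuous sw.
  apply: continuous_pair => [|p]; last first.
    by apply: continuous_comp; [exact: cvg_fst|exact: cvg_snd].
  apply: continuous_pair => p; last exact: cvg_snd.
  by apply: continuous_comp; exact: cvg_fst.
have cD : closed ([set: 'rV[R]_d] `*` B) by apply: closed_setX => //; exact: closedT.
have ch1 : clevel ([set: 'rV[R]_d] `*` B `*` A) h1.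
  move=> r; move/continuous_closedP : csw => csw.
  have [V1 V2] := cV r; rewrite setTI in V1; rewrite setTI in V2; split.
    have := csw _ (closed_dynamics V1); congr closed.
    by apply/seteqP; split=> -[[x y] z] /= [[[_ ?] ?] ?].
  have := csw _ (closed_dynamics V2); congr closed.
  by apply/seteqP; split=> -[[x y] z] /= [[[_ ?] ?] ?].
have [a [ma Ha]] := @measurable_argmin _ _ ('rV[R]_d * 'rV[R]_nB)%type _ id _ _ _ _
  (@closed_measurable_prod _ _ _) cD cA A0 ch1.
pose m p := h1 (p, a p).
have cm : clevel ([set: 'rV[R]_d] `*` B) m.
  apply: (clevel_min cD cA ch1) => p Dp; have [Aa Hm] := Ha _ Dp.
  by split; first exists (a p).
(* Maximizing [m] is minimizing its opposite. *)
have [b [mb Hb]] := @measurable_argmin _ _ ('rV[R]_d : measurableType _) _ id _ _ _ _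
  (@closed_measurable_mx _ _ _) closedT cB B0 (clevelN cm).
pose W x := m (x, b x).
have cW : clevel setT W.
  rewrite (_ : W = fun x => - - W x); last by apply/funext => x; rewrite opprK.
  apply: clevelN; apply: (clevel_min closedT cB (clevelN cm)) => x _.
  by have [Bb Hm] := Hb x I; split; first exists (b x).
exists (fun x => Num.max (g x) (W x)), a, b; split.
- by apply: clevel_max => //; exact: clevel_continuous.
- by split=> [|x c Bc]; [exact: measurable_funTS|have [] := Ha (x, c) (conj I Bc)].
- by split=> // x; have [] := Hb x I.
- move=> x c Bc; rewrite ge_max !le_max lexx/=; apply/orP; right.
  by have [_ /(_ _ Bc)] := Hb x I; rewrite lerN2.
- move=> x c Ac; rewrite ge_max !le_max lexx/=; apply/orP; right.
  by have [Bb _] := Hb x I; have [_] := Ha (x, b x) (conj I Bb); exact.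
Qed.

Lemma bellman_saddle : exists (W : nat -> 'rV[R]_d -> R) a b,
  [/\ W 0%N = phi, forall n, measurable_fun setT (W n),
      forall n, strategies A B (a n) /\ controls B (b n),
      forall n x c, B c -> Num.max (g x) (W n (F x (a n (x, c)) c)) <= W n.+1 x
    & forall n x c, A c -> W n.+1 x <= Num.max (g x) (W n (F x c (b n x)))].
Proof.
(* Bundling each value function with its regularity yields a choice function that can be
   iterated. *)
have /choice[next Hnext] (V : {V : 'rV[R]_d -> R | clevel setT V}) :
  exists Wab : {V : 'rV[R]_d -> R | clevel setT V} *
      (('rV[R]_d * 'rV[R]_nB -> 'rV[R]_nA) * ('rV[R]_d -> 'rV[R]_nB)),
    [/\ strategies A B Wab.2.1, controls B Wab.2.2,
        forall x c, B c ->
          Num.max (g x) (sval V (F x (Wab.2.1 (x, c)) c)) <= sval Wab.1 x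
      & forall x c, A c ->
          sval Wab.1 x <= Num.max (g x) (sval V (F x c (Wab.2.2 x)))].
  have [W [a [b [cW ? ? ? ?]]]] := bellman_step (svalP V).
  by exists (exist _ W cW, (a, b)); split.
pose V n := iter n (fun V => (next V).1)
  (exist (clevel setT) phi (clevel_continuous cphi)).
exists (fun n => sval (V n)), (fun n => (next (V n)).2.1), (fun n => (next (V n)).2.2).
split=> // [n|n|n x c Bc|n x c Ac].
- exact: (@clevel_measurable _ _ ('rV[R]_d : measurableType _) _ id _
    (@closed_measurable_mx _ _ _) (svalP (V n))).
- by case: (Hnext (V n)).
- by have [_ _ + _] := Hnext (V n); exact.
- by have [_ _ _] := Hnext (V n); exact.
Qed.

End saddle.

(** * Costs by recursion on the stages *)

Fixpoint all_in (T : Type) (S : set T) (s : seq T) : Prop :=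
  if s is x :: s' then S x /\ all_in S s' else True.

Lemma all_in_power (T : Type) (S : set T) n (t : n.-tuple T) :
  power n S t <-> all_in S t.
Proof.
elim: n t => [|n IH] t; first by rewrite [t]tuple0; split=> // _ [].
case/tupleP: t => x t; split=> /= [pt|[Sx /IH pt] i].
  split; first by have := pt ord0; rewrite tnth0.
  by apply/IH => i; have := pt (lift ord0 i); rewrite tnthS.
by case: (unliftP ord0 i) => [j ->|->]; rewrite ?tnthS ?tnth0.
Qed.

Lemma all_in_map (T U : Type) (S : set U) (f : T -> U) (s : seq T) :
  all_in S [seq f x | x <- s] <-> all_in (f @^-1` S) s.
Proof. by elim: s => //= x s ->. Qed.

Section sequential_cost.
Context {R : realType} {d nA nB : nat}.
Local Notation state := 'rV[R]_d.
Local Notation strategy := ('rV[R]_d * 'rV[R]_nB -> 'rV[R]_nA).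
Local Notation control := ('rV[R]_d -> 'rV[R]_nB).
Variables (g phi : state -> R) (F : state -> 'rV[R]_nA -> 'rV[R]_nB -> state).

Definition next_state (al : strategy) (b : control) (x : state) :=
  F x (al (x, b x)) (b x).

(** Splitting off the first move instead of the last state gives the form suited to dynamic
    programming. *)
Fixpoint scost (als : seq strategy) (bs : seq control) (x : state) : R :=
  if als is al :: als' then
    if bs is b :: bs' then
      Num.max (g x) (scost als' bs' (next_state al b x))
    else phi x
  else phi x.

Lemma cost_scost N (al : N.-tuple strategy) (b : N.-tuple control) x :
  cost F g phi al b x = scost al b x.
Proof.
elim: N al b x => [|N IH] al b x.
  by rewrite /cost big_ord0 [al]tuple0.
case/tupleP: al => a al; case/tupleP: b => c b.
have trajS k : traj F [tuple of a :: al] [tuple of c :: b] x k.+1 =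
    traj F al b (next_state a c x) k.
  by elim: k => // k IHk; rewrite [RHS]/= -IHk.
rewrite /= -IH /cost big_ord_recl /=; congr (Num.max _ _).
by rewrite -trajS; apply: eq_bigr => i _; rewrite -trajS.
Qed.

(* The controls met along a trajectory form an open-loop control. *)
Fixpoint open_loop (als : seq strategy) (bs : seq control) (x : state) :
    seq 'rV[R]_nB :=
  if als is al :: als' then
    if bs is b :: bs' then b x :: open_loop als' bs' (next_state al b x)
    else [::]
  else [::].

Definition const_seq (cs : seq 'rV[R]_nB) : seq control :=
  [seq (fun=> c) | c <- cs].

Lemma size_open_loop als bs x : size als = size bs ->
  size (open_loop als bs x) = size bs.
Proof. by elim: als bs x => [|al als IH] [|b bs] x //= [/IH ->]. Qed.

(** Replaying the recorded controls visits the same states; thus, from a fixed initial state,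
    constant controls do as well as feedback ones. *)
Lemma scost_open_loop als bs x : size als = size bs ->
  scost als (const_seq (open_loop als bs x)) x = scost als bs x.
Proof. by elim: als bs x => [|al als IH] [|b bs] x //= [/IH ->]. Qed.

Section measurability.
Context {A : set 'rV[R]_nA} {B : set 'rV[R]_nB}.
Hypotheses (mg : measurable_fun setT g) (mphi : measurable_fun setT phi).
Hypothesis (mB : measurable B).
Hypothesis (mF : forall dT (T : measurableType dT) (D : set T) u v w,
  measurable D -> measurable_fun D u -> measurable_fun D v ->
  measurable_fun D w -> (forall t, D t -> A (v t) /\ B (w t)) ->
  measurable_fun D (fun t => F (u t) (v t) (w t))).

Lemma measurable_play dT (T : measurableType dT) (D : set T) al u w :
  measurable D -> strategies A B al -> measurable_fun D u -> measurable_fun D w ->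
  (forall t, D t -> B (w t)) ->
  measurable_fun D (fun t => F (u t) (al (u t, w t)) (w t)).
Proof.
move=> mD [mal Aal] mu mw Bw; apply: mF => //; last first.
  by move=> t Dt; split; [apply: Aal; exact: Bw|exact: Bw].
apply: (@measurable_comp _ _ _ _ _ _ ([set: state] `*` B)) mal _.
- exact: measurableX.
- by move=> _ [t Dt <-]; split => //; exact: Bw.
- exact: measurable_fun_pair_on.
Qed.

Lemma measurable_next_state al b : strategies A B al -> controls B b ->
  measurable_fun setT (next_state al b).
Proof. by move=> sal [mb Bb]; apply: measurable_play. Qed.

Lemma measurable_scost als bs :
  all_in (strategies A B) als -> all_in (controls B) bs ->
  measurable_fun setT (scost als bs).
Proof.
elim: als bs => [|al als IH] [|b bs] //= [sal sals] [sb sbs].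
apply: measurable_maxr => //; apply: measurableT_comp; first exact: IH.
exact: measurable_next_state.
Qed.

(** The controls ignore the state but vary with a parameter [t]. Taking for [t] a pair of a state
    and an open-loop control makes the set of successful pairs measurable. *)
Lemma measurable_scost_const dT (T : measurableType dT) (D : set T) als
    (cs : seq (T -> 'rV[R]_nB)) u :
  measurable D -> all_in (strategies A B) als -> measurable_fun D u ->
  all_in [set c | measurable_fun D c /\ forall t, D t -> B (c t)] cs ->
  measurable_fun D (fun t => scost als (const_seq [seq c t | c <- cs]) (u t)).
Proof.
move=> mD; elim: als cs u => [|al als IH] [|c cs] u /=;
  try by move=> *; exact: measurableT_comp.
move=> [sal sals] mu [[mc Bc] mcs].
apply: measurable_maxr; first exact: measurableT_comp.
by apply: IH => //; exact: measurable_play.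
Qed.

End measurability.
End sequential_cost.

(** * From open-loop to feedback controls *)

(** Serves for the law of [X], for the law of the next state, and, with [f] the identity, for
    restricting a law. *)
Lemma restr_image_measure d1 d2 (T1 : measurableType d1) (T2 : measurableType d2)
    (R : realType) (mu : {measure set T1 -> \bar R}) (D : set T1) (f : T1 -> T2) :
  measurable D -> measurable_fun setT f ->
  exists nu : {measure set T2 -> \bar R}, forall M, nu M = mu (f @^-1` M `&` D).
Proof.
move=> mD mf.
pose m0 : {measure set T1 -> \bar R} := mrestr mu mD.
pose nu : {measure set T2 -> \bar R} := pushforward m0 f.
by exists (nu mf).
Qed.

Lemma measurable_piecewise d1 d2 (T1 : measurableType d1) (T2 : measurableType d2)
    (D : set T1) (f g : T1 -> T2) :
  measurable D -> measurable_fun setT f -> measurable_fun setT g ->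
  measurable_fun setT (fun x => if `[< D x >] then f x else g x).
Proof.
move=> mD mf mg _ Y mY; rewrite setTI.
rewrite (_ : _ @^-1` _ = (D `&` f @^-1` Y) `|` (~` D `&` g @^-1` Y)).
  apply: measurableU; apply: measurableI => //.
  - by rewrite -[X in measurable X]setTI; exact: mf.
  - exact: measurableC.
  - by rewrite -[X in measurable X]setTI; exact: mg.
by apply/seteqP; split=> x /=; case: asboolP => Dx; [left|right|case=> -[]|case=> -[]].
Qed.

Lemma measurable_gtr d1 (T : measurableType d1) (R : realType) (D : set T)
    (f : T -> R) (q : R) :
  measurable D -> measurable_fun D f -> measurable (D `&` [set x | q < f x]).
Proof.
move=> mD mf; have := mf mD `]q, +oo[%classic (measurable_itv _).
by congr measurable; apply/seteqP; split=> x /=; rewrite in_itv/= andbT.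
Qed.

Lemma non_negligible_gt0 d1 (T : measurableType d1) (R : realType)
    (mu : {measure set T -> \bar R}) (S : set T) :
  measurable S -> ~ mu.-negligible S -> (0 < mu S)%E.
Proof.
move=> mS nS; rewrite lt0e measure_ge0 andbT; apply/eqP => S0; apply: nS.
by exists S; split.
Qed.

Lemma compact_measurable_multi (R : realType) d m (K : set ('rV[R]_d * 'rV[R]_m)) :
  compact K -> measurable_multi (fun x : 'rV[R]_d => [set z | K (x, z)]).
Proof.
move=> cK; have c2 : continuous (snd : 'rV[R]_d * 'rV[R]_m -> _).
  by move=> p; exact: cvg_snd.
have c1 : continuous (fst : 'rV[R]_d * 'rV[R]_m -> _).
  by move=> p; exact: cvg_fst.
split=> [x|C cC].
  rewrite (_ : mkset _ = snd @` (K `&` fst @^-1` [set x])).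
    apply: continuous_compact; first exact: continuous_subspaceT.
    apply: compact_closedI => //; move/continuous_closedP : c1; apply.
    by apply: compact_closed; [exact: norm_hausdorff|exact: compact_set1].
  apply/seteqP; split=> z /=; first by move=> Kz; exists (x, z).
  by move=> [[x' z'] [Kz /= <-] <-].
apply: closed_measurable_mx; apply: compact_closed; first exact: norm_hausdorff.
rewrite (_ : mkset _ = fst @` (K `&` snd @^-1` C)).
  apply: continuous_compact; first exact: continuous_subspaceT.
  by apply: compact_closedI => //; move/continuous_closedP : c2; exact.
apply/seteqP; split=> x /=; first by move=> [z [Kz Cz]]; exists (x, z).
by move=> [[x' z'] [Kz /= Cz] <-]; exists z'.
Qed.

Lemma compact_box (R : realType) n (M : R) :
  compact [set x : 'rV[R]_n | forall i, `[- M, M]%classic (x ord0 i)].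
Proof. by apply: (@rV_compact _ _ (fun=> `[- M, M]%classic)) => i; exact: segment_compact. Qed.

(** Capacitability shrinks [E] to a compact set whose projection still has positive measure; its
    sections form a measurable multifunction, to which selection applies. *)
Lemma measurable_uniformization (R : realType) d m
    (mu : {measure set 'rV[R]_d -> \bar R}) (E : set ('rV[R]_d * 'rV[R]_m)) :
  (mu setT < +oo)%E -> measurable E -> ~ mu.-negligible (fst @` E) ->
  exists D (s : 'rV[R]_d -> 'rV[R]_m), [/\ measurable D, (0 < mu D)%E,
    measurable_fun setT s & forall x, D x -> E (x, s x)].
Proof.
move=> mufin mE nE.
pose Q (M : nat) := [set x : 'rV[R]_d | forall i, `[- M%:R, M%:R]%classic (x ord0 i)] `*`
  [set x : 'rV[R]_m | forall i, `[- M%:R, M%:R]%classic (x ord0 i)].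
have c1 : continuous (fst : 'rV[R]_d * 'rV[R]_m -> _).
  by move=> p; exact: cvg_fst.
have [||||K [cK KE muK]] := @suslin_compact_approx R d _ mu Q fst E mufin _ _ _ c1 _ nE.
- by move=> M; apply: compact_setX; exact: compact_box.
- move=> i j ij [x z] [/= Hx Hz]; split=> k /=.
    move: (Hx k); rewrite /= !in_itv/= -!ler_norml => /le_trans; apply.
    by rewrite ler_nat.
  move: (Hz k); rewrite /= !in_itv/= -!ler_norml => /le_trans; apply.
  by rewrite ler_nat.
- apply/seteqP; split=> // -[x z] _.
  have coord n (v : 'rV[R]_n) k : `|v ord0 k| <= \sum_l `|v ord0 l|.
    by rewrite (bigD1 k)//= lerDl sumr_ge0.
  have sum0 n (v : 'rV[R]_n) : 0 <= \sum_l `|v ord0 l| by rewrite sumr_ge0.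
  (* The sum of all absolute values bounds every coordinate, so this box contains both
     components. *)
  exists (Num.truncn (\sum_l `|x ord0 l| + \sum_l `|z ord0 l|)).+1 => //.
  split=> k /=; rewrite in_itv/= -ler_norml; apply: (le_trans _ (ltW (truncnS_gt _))).
    by apply: (le_trans (coord _ x k)); rewrite lerDl sum0.
  by apply: (le_trans (coord _ z k)); rewrite lerDr sum0.
- exact: measurable_prod_suslin.
have [s [ms Hs]] := measurable_selection (compact_measurable_multi cK).
exists (fst @` K), s; split=> //.
  apply: closed_measurable_mx; apply: compact_closed; first exact: norm_hausdorff.
  by apply: continuous_compact => //; exact: continuous_subspaceT.
move=> _ [[x z] Kz <-]; apply: KE; apply: (Hs x).
by exists z.
Qed.

Section dynamic_programming.
Context {R : realType} {d nA nB : nat} {A : set 'rV[R]_nA} {B : set 'rV[R]_nB}.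
Context {g phi : 'rV[R]_d -> R} {F : 'rV[R]_d -> 'rV[R]_nA -> 'rV[R]_nB -> 'rV[R]_d}.
Local Notation state := 'rV[R]_d.
Local Notation strategy := ('rV[R]_d * 'rV[R]_nB -> 'rV[R]_nA).
Local Notation control := ('rV[R]_d -> 'rV[R]_nB).
Hypotheses (mg : measurable_fun setT g) (mphi : measurable_fun setT phi).
Hypotheses (mB : measurable B) (B0 : B !=set0).
Hypothesis (mF : forall dT (T : measurableType dT) (D : set T) u v w,
  measurable D -> measurable_fun D u -> measurable_fun D v ->
  measurable_fun D w -> (forall t, D t -> A (v t) /\ B (w t)) ->
  measurable_fun D (fun t => F (u t) (v t) (w t))).
Context {W : nat -> state -> R} {a : nat -> strategy} {b : nat -> control}.
Hypothesis (W0 : W 0%N = phi).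
Hypothesis (mW : forall n, measurable_fun setT (W n)).
Hypothesis (sab : forall n, strategies A B (a n) /\ controls B (b n)).
Hypothesis (Wa : forall n x c, B c ->
  Num.max (g x) (W n (F x (a n (x, c)) c)) <= W n.+1 x).
Hypothesis (Wb : forall n x c, A c ->
  W n.+1 x <= Num.max (g x) (W n (F x c (b n x)))).

(** [W], [a] and [b] are indexed by the number of moves left after the current one or at the current
    state, hence the decreasing order. *)
Fixpoint countdown (T : Type) (f : nat -> T) (n : nat) : seq T :=
  if n is k.+1 then f k :: countdown f k else [::].

Lemma size_countdown (T : Type) (f : nat -> T) n : size (countdown f n) = n.
Proof. by elim: n => //= n ->. Qed.

Lemma countdown_strategies n : all_in (strategies A B) (countdown a n).
Proof. by elim: n => //= n IH; split=> //; case: (sab n). Qed.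

Lemma countdown_controls n : all_in (controls B) (countdown b n).
Proof. by elim: n => //= n IH; split=> //; case: (sab n). Qed.

Local Notation cost := (scost g phi F).

Lemma scost_saddle_le n bs x : size bs = n -> all_in (controls B) bs ->
  cost (countdown a n) bs x <= W n x.
Proof.
elim: n bs x => [|n IH] [|c bs] x //=; first by rewrite W0.
move=> [sz] [[_ Bc] sbs]; apply: le_trans (Wa _ _ (Bc x)).
by rewrite ge_max !le_max lexx IH ?orbT.
Qed.

Lemma scost_saddle_ge n als x : size als = n -> all_in (strategies A B) als ->
  W n x <= cost als (countdown b n) x.
Proof.
elim: n als x => [|n IH] [|al als] x //=; first by rewrite W0.
move=> [sz] [[_ Aal] sals].
have [_ [_ Bb]] := sab n.
apply: le_trans (Wb _ _ (Aal x (b n x) (Bb x))) _.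
by rewrite ge_max !le_max lexx IH ?orbT.
Qed.

Lemma open_loop_in als bs x : size als = size bs -> all_in (controls B) bs ->
  all_in B (open_loop F als bs x).
Proof.
by elim: als bs x => [|al als IH] [|c bs] x //= [sz] [[_ Bc] sbs]; split=> //; exact: IH.
Qed.

Definition open_loop_exceeds (als : seq strategy) (q : R) : set state :=
  [set x | exists cs, [/\ size cs = size als, all_in B cs &
                          q < cost als (const_seq cs) x]].

(* An open-loop selection is turned into a feedback one stage at a time, the law
   being pushed forward along the first move; b n is played wherever W (n + 1)
   exceeds q already or the remaining stages do not guarantee exceeding q. *)
Lemma feedback_exceeds n als (mu : {measure set state -> \bar R}) q :
  (mu setT < +oo)%E -> size als = n -> all_in (strategies A B) als ->
  ~ mu.-negligible (open_loop_exceeds als q) ->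
  exists bs, [/\ size bs = n, all_in (controls B) bs,
    forall x, W n x <= cost als bs x & (0 < mu [set x | (q < cost als bs x)%R])%E].
Proof.
elim: n als mu => [|n IH] als mu mufin sz sals nS.
  move/size0nil : sz sals nS => ->.
  move=> _ nS; exists [::]; split=> //=; first by move=> x; rewrite W0.
  apply: non_negligible_gt0.
    by rewrite -[X in measurable X]setTI; exact: measurable_gtr.
  by apply: contra_not nS; apply: negligibleS => x [cs [_ _]].
case: als sz sals nS => // al als [sz] /= [sal sals] nS.
have mgq : measurable [set x | q < g x].
  by rewrite -[X in measurable X]setTI; exact: measurable_gtr.
(* If [g] alone exceeds [q] with positive measure, [countdown b] suffices, the cost being at least
   [g]. Otherwise that set is null and the excess must come from later states. *)
have [gq|] := ltP 0%E (mu [set x | (q < g x)%R]).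
  exists (countdown b n.+1); split.
  - exact: size_countdown.
  - exact: countdown_controls.
  - by move=> x; apply: (@scost_saddle_ge n.+1 (al :: als)) => //=; rewrite sz.
  - apply: lt_le_trans gq _; rewrite le_measure ?inE//.
      rewrite -[X in measurable X]setTI; apply: measurable_gtr => //.
      exact: (measurable_scost mg mphi mB mF (als := al :: als)
        (bs := countdown b n.+1) (conj sal sals) (countdown_controls n.+1)).
    by move=> x /= gx; rewrite lt_max gx.
rewrite measure_le0 => /eqP gq0.
(* The [n.+1] controls are flattened into one row vector, so that uniformization applies to a
   product of two row spaces. *)
pose sel (i : 'I_n.+1) (z : 'rV[R]_(n.+1 * nB)) : 'rV[R]_nB :=
  \row_j z ord0 (mxvec_index i j).
have msel i : measurable_fun setT (sel i).
  apply: measurable_fun_mx => k j; rewrite /sel; under eq_fun do rewrite mxE.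
  exact: measurable_coord_mx.
pose DB := [set p : state * 'rV[R]_(n.+1 * nB) |
  g p.1 <= q /\ forall i, B (sel i p.2)].
have mDB : measurable DB.
  rewrite (_ : DB = (fst @^-1` (~` [set x | q < g x])) `&`
      \bigcap_(i in [set: 'I_n.+1]) ((fun p => sel i p.2) @^-1` B)).
    apply: measurableI.
      rewrite -[X in measurable X]setTI; apply: measurable_fst => //.
      exact: measurableC.
    apply: fin_bigcap_measurable => // i _.
    rewrite -[X in measurable X]setTI.
    by apply: (measurableT_comp (msel i) measurable_snd).
  apply/seteqP; split=> -[x z] /= [gx Hz].
    by split; [apply/negP; rewrite -leNgt|move=> i _; exact: Hz].
  by split; [rewrite leNgt; apply/negP|move=> i; exact: Hz].
pose cs := [seq (fun p : state * 'rV[R]_(n.+1 * nB) => sel i p.2) | i <- enum 'I_n.+1].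
pose E := DB `&` [set p |
  q < cost (al :: als) (const_seq [seq c p | c <- cs]) p.1].
have mE : measurable E.
  apply: measurable_gtr => //.
  apply: (measurable_scost_const mg mphi mB mF) => //.
    by apply: measurable_funTS; exact: measurable_fst.
  rewrite /cs all_in_map; elim: (enum _) => //= i l IHl; split=> //; split.
    by apply: measurable_funTS; exact: measurableT_comp (msel i) measurable_snd.
  by move=> p [].
have nE : ~ mu.-negligible (fst @` E).
  move=> NE; apply: nS.
  have NgE : mu.-negligible ([set x | q < g x] `|` fst @` E).
    by apply: negligibleU => //; exists [set x | q < g x]; split.
  apply: negligibleS NgE => x [us [szu Bu qu]].
  have [gx|gx] := ltP q (g x); first by left.
  right; pose z : 'rV[R]_(n.+1 * nB) := mxvec (\matrix_(i, j) (nth 0 us i) ord0 j).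
  have selz i : sel i z = nth 0 us i.
    by apply/rowP => j; rewrite mxE mxvecE mxE.
  have csz : [seq c (x, z) | c <- cs] = us.
    rewrite /cs -map_comp.
    apply: (@eq_from_nth _ 0); rewrite size_map size_enum_ord ?szu /= ?sz//.
    move=> i ilt; rewrite (nth_map ord0) ?size_enum_ord//= selz.
    by rewrite nth_enum_ord.
  exists (x, z) => //; split; last by rewrite /= csz.
  split=> //= i; rewrite selz.
  have : (i < size us)%N by rewrite szu /= sz.
  elim: (us) (nat_of_ord i) Bu => //= u l IHl [|k] [Bu Bl]//=.
  by rewrite ltnS; exact: IHl.
have [D [s [mD muD ms Es]]] := measurable_uniformization mufin mE nE.
have [cB BcB] := B0.
(* Only the first selected control is used now; the later ones merely witness that the next state
   can still exceed [q]. *)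
pose c0 x := if `[< D x >] then sel ord0 (s x) else cB.
have sc0 : controls B c0.
  split; first by apply: measurable_piecewise => //; exact: measurableT_comp.
  by move=> x; rewrite /c0; case: asboolP => // /Es[[_]].
have mG := measurable_next_state mB mF sal sc0.
have [nu Hnu] := restr_image_measure mu mD mG.
have [||||bs [szb sbs Wbs qbs]] := IH als nu.
- rewrite Hnu; apply: le_lt_trans mufin; rewrite le_measure ?inE//.
  by rewrite preimage_setT setTI.
- exact: sz.
- exact: sals.
(* Every state of [D] moves to one from which exceeding [q] is possible. A null cover [M] of such
   states would thus give [mu D = nu M = 0]. *)
- move=> [M [mM nuM SM]]; move: muD; rewrite (_ : D = next_state F al c0 @^-1` M `&` D).
    by rewrite -Hnu nuM ltxx.
  apply/seteqP; split=> [x Dx|x []//]; split=> //=; apply: SM.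
  have [[gx Bs]] := Es _ Dx.
  rewrite /cs enum_ordSl /= lt_max ltNge gx /= => qs.
  exists [seq c (x, s x) | c <- [seq (fun p => sel i p.2) |
    i <- [seq lift ord0 i | i <- enum 'I_n]]]; split.
  + by rewrite 3!size_map size_enum_ord sz.
  + do 3 apply/all_in_map; elim: (enum _) => //= i l IHl; split=> //; exact: Bs.
  + by move: qs; rewrite /next_state /c0 asboolT.
have mnext : measurable_fun setT (cost als bs \o next_state F al c0).
  exact: measurableT_comp (measurable_scost mg mphi mB mF sals sbs) mG.
(* Keeping [c0] only where [W n.+1] is at most [q] and the continuation exceeds [q] makes the cost
   dominate [W n.+1] there too. *)
pose D' := D `&` (~` [set x | q < W n.+1 x] `&`
  [set x | q < cost als bs (next_state F al c0 x)]).
have mWq : measurable [set x | q < W n.+1 x].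
  by rewrite -[X in measurable X]setTI; exact: measurable_gtr.
have mD' : measurable D'.
  apply: measurableI => //; apply: measurableI; first exact: measurableC.
  by rewrite -[X in measurable X]setTI; exact: measurable_gtr.
pose b0 x := if `[< D' x >] then c0 x else b n x.
have sb0 : controls B b0.
  have [_ [mbn Bbn]] := sab n; have [mc0 Bc0] := sc0.
  split; first exact: measurable_piecewise.
  by move=> x; rewrite /b0; case: asboolP.
have Wb0 x : ~ D' x -> W n.+1 x <= cost (al :: als) (b0 :: bs) x.
  move=> nD'; rewrite /= /next_state /b0 asboolF//.
  have [_ [_ Bb]] := sab n; have [_ Aal] := sal.
  apply: le_trans (Wb _ _ (Aal x (b n x) (Bb x))) _.
  by rewrite ge_max !le_max lexx Wbs ?orbT.
have qD' x : D' x -> q < cost (al :: als) (b0 :: bs) x.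
  move=> D'x; rewrite /= lt_max; apply/orP; right.
  by case: (D'x) => _ [_]; rewrite /next_state /b0 asboolT.
exists (b0 :: bs); split=> [||x|] /=.
- by rewrite szb.
- by split.
- have [D'x|] := pselect (D' x); last exact: Wb0.
  apply: ltW; apply: le_lt_trans (qD' _ D'x); case: D'x => _ [nW _].
  by rewrite leNgt; apply/negP.
- apply: lt_le_trans qbs _; rewrite Hnu le_measure ?inE//.
  + apply: measurableI => //.
    by rewrite -[X in measurable X]setTI; exact: measurable_gtr.
  + rewrite -[X in measurable X]setTI; apply: measurable_gtr => //.
    exact: (measurable_scost mg mphi mB mF (als := al :: als) (bs := b0 :: bs)
      (conj sal sals) (conj sb0 sbs)).
  (* A successful point of [D] outside [D'] has [W n.+1] above [q], so [b n] makes the cost exceed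
     [q] as well. *)
  + move=> x [/= qx Dx]; have [D'x|nD'x] := pselect (D' x); first exact: qD'.
    apply: lt_le_trans (Wb0 _ nD'x); apply: contrapT => nW; apply: nD'x.
    by split.
Qed.

End dynamic_programming.

(** * Mean costs *)

Section integral_order.
Context dT (T : measurableType dT) (R : realType) (mu : {measure set T -> \bar R}).
Local Open Scope ereal_scope.

(** The integral of a nonnegative function is a supremum over simple functions below it, hence
    monotone without measurability. This accommodates a density that is Lebesgue but not Borel
    measurable. *)
Lemma ge0_le_integral_nonmeasurable (D : set T) (f h : T -> \bar R) :
  (forall x, D x -> 0 <= f x) -> (forall x, D x -> f x <= h x) ->
  \int[mu]_(x in D) f x <= \int[mu]_(x in D) h x.
Proof.
move=> f0 fh; rewrite !ge0_integralE//; last by move=> x Dx; exact: le_trans (f0 _ Dx) (fh _ Dx).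
apply: ereal_sup_le => _ [k kf <-]; exists k => // x.
apply: le_trans (kf x) _; rewrite !patchE; case: ifPn => // xD.
by apply: fh; exact: set_mem.
Qed.

(** Comparing positive and negative parts separately avoids any integrability assumption, as the
    mean costs may be infinite. *)
Lemma le_integral_measurable (f h : T -> \bar R) :
  measurable_fun setT f -> measurable_fun setT h -> (forall x, f x <= h x) ->
  \int[mu]_x f x <= \int[mu]_x h x.
Proof.
move=> mf mh fh; rewrite integralE [leRHS]integralE; apply: leeB.
  apply: ge0_le_integral => //; do ?exact: measurable_funepos.
  by move=> x _; apply: (@funepos_le _ _ setT); rewrite ?inE.
apply: ge0_le_integral => //; do ?exact: measurable_funeneg.
by move=> x _; apply: (@funeneg_le _ _ setT); rewrite ?inE.
Qed.

Lemma integrable_of_upper (f : T -> \bar R) :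
  measurable_fun setT f -> \int[mu]_x f^\- x < +oo -> \int[mu]_x f x < +oo ->
  mu.-integrable setT f.
Proof.
move=> mf fneg fi; apply/integrableP; split=> //.
under eq_integral do rewrite -[`|f _|]/((abse \o f) _) fune_abse.
rewrite ge0_integralD//; do ?[exact: measurable_funepos|exact: measurable_funeneg].
apply: lte_add_pinfty => //.
rewrite ltey; apply/eqP => fp; move: fi; rewrite integralE fp addye ?ltxx//.
by rewrite eqe_oppLR/= lt_eqF.
Qed.

(** [h] is integrable too, being above [f] with no larger integral, so the nonnegative [h - f]
    integrates to zero. *)
Lemma integral_le_eq_negligible (f h : T -> R) (S : set T) :
  mu.-integrable setT (EFin \o f) -> measurable_fun setT h ->
  (forall x, (f x <= h x)%R) -> \int[mu]_x (h x)%:E <= \int[mu]_x (f x)%:E ->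
  (forall x, S x -> (f x < h x)%R) -> mu.-negligible S.
Proof.
move=> fi mh fh hf Sfh; have mEh : measurable_fun setT (EFin \o h).
  exact/measurable_EFinP.
have [mf _] := integrableP _ _ _ fi.
have hi : mu.-integrable setT (EFin \o h).
  apply: integrable_of_upper => //.
    apply: le_lt_trans (integral_funeneg_lt_pinfty measurableT fi).
    apply: ge0_le_integral => //; do ?exact: measurable_funeneg.
    by move=> x _; apply: (@funeneg_le _ _ setT); rewrite ?inE// => y _; rewrite lee_fin.
  exact: le_lt_trans hf (integrable_lty measurableT fi).
have mk : measurable_fun setT (fun x => (h x - f x)%:E).
  apply/measurable_EFinP; apply: measurable_funB => //.
  exact/measurable_EFinP.
have k0 : \int[mu]_x `|(h x - f x)%:E| = 0.
  under eq_integral do rewrite gee0_abs ?lee_fin ?subr_ge0// EFinB.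
  apply/eqP; rewrite eq_le; apply/andP; split.
    by rewrite integralB// sube_le0.
  by apply: integral_ge0 => x _; rewrite -EFinB lee_fin subr_ge0.
have /(ae_eq_integral_abs mu measurableT mk) [M [mM M0 HM]] := k0.
exists M; split=> // x /Sfh fhx; apply: HM => /= /(_ I) [].
by apply/eqP; rewrite subr_eq0 gt_eqF.
Qed.

End integral_order.

(** Up to a null set, [rho] is at least 1/(k+1) on a Borel set [C]; the vanishing integral over the
    part of [C] in [M] bounds its measure by zero. *)
Lemma density_negligible dT (T : measurableType dT) (R : realType)
    (mu : {measure set T -> \bar R}) (rho : T -> R) (M : set T) :
  (forall Y : set R, measurable Y -> completed_algebra_gen mu (rho @^-1` Y)) ->
  measurable M ->
  (forall E, measurable E -> E `<=` M -> (\int[mu]_(x in E) (rho x)%:E = 0)%E) ->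
  mu.-negligible (M `&` [set x | 0 < rho x]).
Proof.
move=> mrho mM rho0.
pose S (k : nat) := M `&` rho @^-1` `[k.+1%:R^-1, +oo[.
apply: (@negligibleS _ _ _ _ (\bigcup_k S k)).
  move=> x [Mx /= rx]; exists (Num.truncn (rho x)^-1) => //; split=> //=.
  by rewrite in_itv/= andbT invf_ple ?posrE// ltW// truncnS_gt.
apply: negligible_bigcup => k.
have [C mC [N negN CN]] := mrho _ (measurable_itv `[k.+1%:R^-1 : R, +oo[).
apply: (@negligibleS _ _ _ _ ((C `&` M) `|` N)).
  move=> x [Mx rx]; have : (C `|` N) x by rewrite CN.
  by move=> [Cx|Nx]; [left|right].
apply: negligibleU => //; exists (C `&` M).
have mCM : measurable (C `&` M) by exact: measurableI.
split=> //; apply/eqP; rewrite eq_le measure_ge0 andbT.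
have k0 : (0 < k.+1%:R^-1 :> R) by rewrite invr_gt0.
suff : ((k.+1%:R^-1)%:E * mu (C `&` M) <= 0)%E by rewrite pmule_rle0.
rewrite -integral_cst// -(rho0 _ mCM (@subIsetr _ _ _)).
apply: ge0_le_integral_nonmeasurable => x [Cx _]; rewrite lee_fin; first exact: ltW.
have : (rho @^-1` `[k.+1%:R^-1, +oo[) x by rewrite -CN; left.
by rewrite /= in_itv/= andbT.
Qed.

Lemma lipschitz_bound (R : realType) (V : normedModType R) (g : V -> R) :
  lipschitz g -> exists2 M, 0 < M & forall x y, `|g x - g y| <= M * `|x - y|.
Proof.
(* The Lipschitz estimate is available for every constant above [M]; this one is also positive. *)
move=> [M [_ HM]]; exists (Num.max 0 M + 1).
  by rewrite ltr_wpDl// le_max lexx.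
move=> x y; apply: (HM (Num.max 0 M + 1) _ (x, y)) => //.
by rewrite (@le_lt_trans _ _ (Num.max 0 M)) ?le_max ?lexx ?orbT// ltrDl.
Qed.

Lemma lipschitz_continuous (R : realType) (V : normedModType R) (g : V -> R) :
  lipschitz g -> continuous g.
Proof.
move=> /lipschitz_bound[M M0 HM] x; apply/cvgrPdist_lt => e e0.
near=> y; apply: le_lt_trans (HM x y) _.
rewrite mulrC -ltr_pdivlMr//; near: y.
by apply: cvgr_dist_lt; [exact: cvg_id|exact: divr_gt0].
Unshelve. all: by end_near. Qed.

(** * The value, its mean and optimal strategies *)

Section mean_cost.
Context (R : realType) (N d nA nB : nat) (A : set 'rV[R]_nA) (B : set 'rV[R]_nB).
Context (g phi : 'rV[R]_d -> R).
Context (F : 'rV[R]_d -> 'rV[R]_nA -> 'rV[R]_nB -> 'rV[R]_d).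
Hypotheses (cA : compact A) (B0 : B !=set0) (cB : compact B).
Hypotheses (cg : continuous g) (cphi : continuous phi).
Hypothesis (cF : {within [set: 'rV[R]_d] `*` A `*` B,
  continuous (fun p => F p.1.1 p.1.2 p.2)}).
Context {W : nat -> 'rV[R]_d -> R} {a : nat -> 'rV[R]_d * 'rV[R]_nB -> 'rV[R]_nA}.
Context {b : nat -> 'rV[R]_d -> 'rV[R]_nB}.
Hypothesis (W0 : W 0%N = phi).
Hypothesis (mW : forall n, measurable_fun setT (W n)).
Hypothesis (sab : forall n, strategies A B (a n) /\ controls B (b n)).
Hypothesis (Wa : forall n x c, B c ->
  Num.max (g x) (W n (F x (a n (x, c)) c)) <= W n.+1 x).
Hypothesis (Wb : forall n x c, A c ->
  W n.+1 x <= Num.max (g x) (W n (F x c (b n x)))).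

Let mfun_of_continuous (h : 'rV[R]_d -> R) : continuous h -> measurable_fun setT h.
Proof.
move=> ch; exact: (@clevel_measurable _ _ ('rV[R]_d : measurableType _) _ id _
    (@closed_measurable_mx _ _ _) (clevel_continuous ch)).
Qed.

Let mg : measurable_fun setT g. Proof. exact: mfun_of_continuous. Qed.
Let mphi : measurable_fun setT phi. Proof. exact: mfun_of_continuous. Qed.
Let mB : measurable B.
Proof.
by apply: closed_measurable_mx; apply: compact_closed => //; exact: norm_hausdorff.
Qed.

Let mF dT (T : measurableType dT) := @measurable_dynamics R d nA nB A B F cA cB cF dT T.

Definition saddle_strategy : N.-tuple ('rV[R]_d * 'rV[R]_nB -> 'rV[R]_nA) :=
  Tuple (introT eqP (size_countdown a N)).

Definition saddle_control : N.-tuple ('rV[R]_d -> 'rV[R]_nB) :=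
  Tuple (introT eqP (size_countdown b N)).

Lemma saddle_strategy_in : power N (strategies A B) saddle_strategy.
Proof. by apply/all_in_power; exact: countdown_strategies sab _. Qed.

Lemma saddle_control_in : power N (controls B) saddle_control.
Proof. by apply/all_in_power; exact: countdown_controls sab _. Qed.

Lemma cost_saddle_le c x : power N (controls B) c ->
  cost F g phi saddle_strategy c x <= W N x.
Proof.
move=> /all_in_power sc; rewrite cost_scost.
by apply: (scost_saddle_le W0 Wa) => //; exact: size_tuple.
Qed.

Lemma cost_saddle_ge al x : power N (strategies A B) al ->
  W N x <= cost F g phi al saddle_control x.
Proof.
move=> /all_in_power sal; rewrite cost_scost.
by apply: (scost_saddle_ge W0 sab Wb) => //; exact: size_tuple.
Qed.

(** The competing constant controls are those recorded when [saddle_control] plays against [al] from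
    [x]. *)
Lemma worst_cost_ge al x : power N (strategies A B) al ->
  ((W N x)%:E <= worst_cost B F g phi al x)%E.
Proof.
move=> sal; have szo : size (open_loop F al saddle_control x) == N.
  by rewrite size_open_loop !size_tuple.
apply: (@le_trans _ _ (cost F g phi al (const_controls d (Tuple szo)) x)%:E).
  rewrite lee_fin (le_trans (cost_saddle_ge x sal))// !cost_scost /=.
  by rewrite scost_open_loop ?size_countdown ?size_tuple.
apply: ereal_sup_ubound; exists (Tuple szo) => //; apply/all_in_power => /=.
apply: open_loop_in; first by rewrite size_countdown size_tuple.
exact: countdown_controls sab _.
Qed.

Lemma const_controls_in c : power N B c -> power N (controls B) (const_controls d c).
Proof.
by move=> sc i; rewrite tnth_map; split=> // x; exact: sc.
Qed.

Lemma worst_cost_saddle x :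
  (worst_cost B F g phi saddle_strategy x <= (W N x)%:E)%E.
Proof.
apply: ge_ereal_sup => _ [c sc <-]; rewrite lee_fin.
by apply: cost_saddle_le; exact: const_controls_in.
Qed.

Lemma value_saddle x : value N A B F g phi x = (W N x)%:E.
Proof.
apply/eqP; rewrite eq_le; apply/andP; split.
  apply: le_trans (worst_cost_saddle x).
  by apply: ereal_inf_lbound; exists saddle_strategy => //; exact: saddle_strategy_in.
by apply: le_ereal_inf_tmp => _ [al sal <-]; exact: worst_cost_ge.
Qed.

Lemma measurable_cost al c : power N (strategies A B) al -> power N (controls B) c ->
  measurable_fun setT (cost F g phi al c).
Proof.
move=> /all_in_power sal /all_in_power sc.
rewrite (_ : cost _ _ _ _ _ = scost g phi F al c).
  exact: (measurable_scost mg mphi mB mF).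
by apply/funext => x; rewrite cost_scost.
Qed.

Section law.
Context {dT : measure_display} {T : measurableType dT} {P : probability T R}.
Context (X : {RV P >-> 'rV[R]_d}).
Local Open Scope ereal_scope.

Let mX : measurable_fun setT X. Proof. exact: measurable_funP. Qed.

Lemma worst_mean_cost_saddle :
  worst_mean_cost B F g phi P X saddle_strategy <= \int[P]_w (W N (X w))%:E.
Proof.
apply: ge_ereal_sup => _ [c sc <-]; rewrite unlock.
apply: le_integral_measurable => [||w].
- apply/measurable_EFinP; apply: measurableT_comp mX.
  exact: measurable_cost saddle_strategy_in sc.
- by apply/measurable_EFinP; exact: measurableT_comp mX.
- by rewrite lee_fin cost_saddle_le.
Qed.

Lemma worst_mean_cost_ge al : power N (strategies A B) al ->
  \int[P]_w (W N (X w))%:E <= worst_mean_cost B F g phi P X al.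
Proof.
move=> sal; apply: le_trans (ereal_sup_ubound _); last first.
  by exists saddle_control; [exact: saddle_control_in|reflexivity].
rewrite unlock; apply: le_integral_measurable => [||w].
- by apply/measurable_EFinP; exact: measurableT_comp mX.
- apply/measurable_EFinP; apply: measurableT_comp mX.
  exact: measurable_cost sal saddle_control_in.
- by rewrite lee_fin cost_saddle_ge.
Qed.

Lemma worst_mean_cost_inf :
  ereal_inf [set worst_mean_cost B F g phi P X al | al in power N (strategies A B)]
  = \int[P]_w (W N (X w))%:E.
Proof.
apply/eqP; rewrite eq_le; apply/andP; split.
  apply: le_trans worst_mean_cost_saddle.
  by apply: ereal_inf_lbound; exists saddle_strategy => //; exact: saddle_strategy_in.
by apply: le_ereal_inf_tmp => _ [al sal <-]; exact: worst_mean_cost_ge.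
Qed.

Lemma optimal_strategy_law al :
  P.-integrable setT (fun w => (W N (X w))%:E) ->
  power N (strategies A B) al ->
  worst_mean_cost B F g phi P X al <= \int[P]_w (W N (X w))%:E ->
  (pushforward P X).-negligible
    [set x | (W N x)%:E < worst_cost B F g phi al x].
Proof.
move=> iW sal opt.
have [mu Hmu] := restr_image_measure P measurableT mX.
have Hmu' M : mu M = P (X @^-1` M) by rewrite Hmu setIT.
suff [M [mM M0 HM]] : mu.-negligible [set x | (W N x)%:E < worst_cost B F g phi al x].
  by exists M; split=> //; rewrite -M0 Hmu'.
have sal' := (all_in_power _ _).1 sal.
pose S (q : rat) := [set x | (W N x < ratr q)%R] `&` @open_loop_exceeds R d nA nB B g phi F al (ratr q).
apply: (@negligibleS _ _ _ _ (\bigcup_k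
    if @unpickle rat k is Some q then S q else set0)).
  move=> x /= /ereal_sup_gt[_ [c sc <-]]; rewrite lte_fin => /rat_in_itvoo[q].
  rewrite in_itv/= => /andP[Wq qc]; exists (pickle q) => //; rewrite pickleK.
  split=> //; exists c; split; [by rewrite !size_tuple|exact/all_in_power|].
  by move: qc; rewrite cost_scost.
apply: negligible_bigcup => k; case: unpickle => [q|]; last exact: negligible_set0.
apply: contrapT => nS.
have mH : measurable [set x | (W N x < ratr q)%R].
  have := mW N measurableT (measurable_itv `]-oo, (ratr q : R)[).
  by rewrite setTI; congr measurable; apply/seteqP; split=> x /=; rewrite in_itv.
(* Restricting the law to [W N < q] ensures that exceeding [q] there means exceeding [W N]. *)
have [nu Hnu] := restr_image_measure mu mH (@measurable_id _ _ setT).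
have [||bs [szb sbs Wbs qbs]] := feedback_exceeds mg mphi mB B0 mF W0 mW sab Wb
  (mu := nu) (q := ratr q) _ (size_tuple al) sal'.
- rewrite Hnu Hmu' preimage_setT setTI; apply: le_lt_trans (ltry 1).
  by apply: probability_le1; rewrite -[X in measurable X]setTI; exact: mX.
- move=> [M [mM M0 SM]]; apply: nS; exists (M `&` [set x | (W N x < ratr q)%R]).
  split; first exact: measurableI.
    by rewrite -Hnu.
  by move=> x [Hx Sx]; split=> //; exact: SM.
pose c : N.-tuple _ := Tuple (introT eqP szb).
have sc : power N (controls B) c by exact/all_in_power.
pose D := [set w | (W N (X w) < cost F g phi al c (X w))%R].
(* By optimality the mean cost of [c] is at most the mean of [W N], while its cost is at least [W N]
   everywhere. *)
have [M [mM M0 DM]] : P.-negligible D.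
  apply: (integral_le_eq_negligible (f := fun w => W N (X w))
    (h := fun w => cost F g phi al c (X w))) => //.
  - by apply: measurableT_comp mX; exact: measurable_cost.
  - by move=> w; rewrite cost_scost; exact: Wbs.
  - apply: le_trans opt; apply: ereal_sup_ubound; exists c => //.
    by rewrite unlock.
move: qbs; rewrite Hnu Hmu' lt_neqAle => /andP[/eqP + _]; apply.
apply/esym/eqP; rewrite eq_le measure_ge0 andbT -M0; apply: le_measure.
- rewrite inE -[X in measurable X]setTI; apply: mX => //; apply: measurableI => //.
  rewrite -[X in measurable X]setTI; apply: measurable_gtr => //.
  exact: (measurable_scost mg mphi mB mF sal' sbs).
- by rewrite inE.
- move=> w [/= qw Ww]; apply: DM; rewrite /D /= cost_scost.
  exact: lt_trans Ww qw.
Qed.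

End law.
End mean_cost.

(** Linear growth controls the negative part by the first moment of [X]; the positive part is
    controlled by the finite upper bound on the mean. *)
Lemma integrable_neg_growth dT (T : measurableType dT) (R : realType) d
    (P : probability T R) (X : {RV P >-> 'rV[R]_d}) (W : 'rV[R]_d -> R) (K M : R) :
  measurable_fun setT W -> 0 <= K -> 0 <= M ->
  (forall x, - W x <= K + M * `|x|) -> (\int[P]_w `|X w|%:E < +oo)%E ->
  (\int[P]_w (W (X w))%:E < +oo)%E ->
  P.-integrable setT (fun w => (W (X w))%:E).
Proof.
move=> mW K0 M0 WKM iX iW.
have mX : measurable_fun setT X by exact: measurable_funP.
have mnX : measurable_fun setT (fun w => `|X w|%:E).
  apply/measurable_EFinP; apply: measurableT_comp mX.
  exact: (@clevel_measurable _ _ ('rV[R]_d : measurableType _) _ id _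
    (@closed_measurable_mx _ _ _) (clevel_continuous (@norm_continuous _ _))).
have mWX : measurable_fun setT (fun w => (W (X w))%:E).
  by apply/measurable_EFinP; exact: measurableT_comp mX.
apply: integrable_of_upper => //.
apply: (@le_lt_trans _ _ (\int[P]_w (K%:E + M%:E * `|X w|%:E))%E).
  apply: ge0_le_integral => //.
  - exact: measurable_funeneg.
  - by apply: emeasurable_funD => //; exact: measurable_funeM.
  - move=> w _; rewrite funenegE ge_max -EFinN -EFinM -EFinD !lee_fin WKM.
    by rewrite addr_ge0// mulr_ge0.
rewrite ge0_integralD//; [|by move=> w _; rewrite mule_ge0 ?lee_fin|exact: measurable_funeM].
rewrite ge0_integralZl// integral_cst//.
apply: lte_add_pinfty; apply: lte_mul_pinfty => //.
by apply: le_lt_trans (ltry 1); exact: probability_le1.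
Qed.

Unset Implicit Arguments.

Theorem theorem3p6 (R : realType) (N d nA nB : nat)
  (A : set 'rV[R]_nA) (B : set 'rV[R]_nB)
  (g phi : 'rV[R]_d -> R)
  (f F : 'rV[R]_d -> 'rV[R]_nA -> 'rV[R]_nB -> 'rV[R]_d)
  (tmax : R)
  (dT : measure_display) (T : measurableType dT) (P : probability T R)
  (X : {RV P >-> 'rV[R]_d})
  (hN : (1 <= N)%N) (hd : (1 <= d)%N) (hnA : (1 <= nA)%N) (hnB : (1 <= nB)%N)
  (hA0 : A !=set0) (hA : compact A) (hB0 : B !=set0) (hB : compact B)
  (hg : lipschitz g) (hphi : lipschitz phi)
  (hf : [lipschitz f p.1.1 p.1.2 p.2 | p in [set: 'rV[R]_d] `*` A `*` B])
  (htmax : 0 < tmax)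
  (hF : {within [set: 'rV[R]_d] `*` A `*` B,
         continuous (fun p => F p.1.1 p.1.2 p.2)})
  (hX : (\int[P]_w `|X w|%:E < +oo)%E) :
  [/\ (\int[P]_w value N A B F g phi (X w))%E =
        (\int[P]_w ereal_inf [set worst_cost B F g phi al (X w)
                             | al in power N (strategies A B)])%E,
      (\int[P]_w ereal_inf [set worst_cost B F g phi al (X w)
                             | al in power N (strategies A B)])%E =
        ereal_inf [set worst_mean_cost B F g phi P X al
                  | al in power N (strategies A B)]
    & forall (Omega : set 'rV[R]_d) (rho : 'rV[R]_d -> R)
        (alstar : N.-tuple ('rV[R]_d * 'rV[R]_nB -> 'rV[R]_nA)),
      (forall Y : set R, measurable Y ->
         completed_algebra_gen (lebesgue_rV R d) (rho @^-1` Y)) ->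
      (forall x, 0 <= rho x) ->
      (forall E : set 'rV[R]_d, measurable E ->
         P (X @^-1` E) = (\int[lebesgue_rV R d]_(x in E) (rho x)%:E)%E) ->
      {ae lebesgue_rV R d, forall x, ~ closure Omega x -> rho x = 0} ->
      {ae lebesgue_rV R d, forall x, Omega x -> 0 < rho x} ->
      (lebesgue_rV R d).-negligible (closure Omega `\` interior Omega) ->
      power N (strategies A B) alstar ->
      worst_mean_cost B F g phi P X alstar =
        ereal_inf [set worst_mean_cost B F g phi P X al
                  | al in power N (strategies A B)] ->
      (worst_mean_cost B F g phi P X alstar < +oo)%E ->
      {ae lebesgue_rV R d, forall x, Omega x ->
         value N A B F g phi x = worst_cost B F g phi alstar x}].
Proof.
have cg := lipschitz_continuous hg; have cphi := lipschitz_continuous hphi.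
have [W [a [b [W0 mW sab Wa Wb]]]] := bellman_saddle hA0 hA hB0 hB cg cphi hF.
have valE x : value N A B F g phi x = (W N x)%:E.
  exact: (value_saddle N W0 sab Wa Wb).
have meanE := worst_mean_cost_inf N hA hB cg cphi hF W0 mW sab Wa Wb X.
have valXE : (\int[P]_w value N A B F g phi (X w))%E = (\int[P]_w (W N (X w))%:E)%E.
  by apply: eq_integral => w _; exact: valE.
split=> //; first by rewrite meanE -valXE.
move=> Omega rho al mrho rho0 rhoX _ rho_pos _ sal opt optfin.
have [M M0 gM] := lipschitz_bound hg.
(* Since [N] is positive, [W N] dominates [g], which decreases at most linearly; the upper bound is
   the finite optimal mean. *)
have iW : P.-integrable setT (fun w => (W N (X w))%:E).
  apply: (@integrable_neg_growth _ _ _ _ _ _ _ `|g 0| M) => //; first exact: ltW.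
    move=> x; have [c Bc] := hB0.
    have gW : g x <= W N x.
      by rewrite -(prednK hN); apply: le_trans (Wa _ x c Bc); rewrite le_max lexx.
    have := gM x 0; rewrite subr0 => gx0.
    have := ler_normD (g x - g 0) (g 0); rewrite subrK => gx.
    have := ler_norm (- g x); rewrite normrN; lra.
  by rewrite -meanE -opt.
have optW : (worst_mean_cost B F g phi P X al <= \int[P]_w (W N (X w))%:E)%E.
  by rewrite opt meanE.
have [E [mE E0 HE]] := optimal_strategy_law hA hB0 hB cg cphi hF W0 mW sab Wb iW sal optW.
(* Every Borel part of [E] is null for the law of [X], so [E] is Lebesgue-null where the density is
   positive. *)
have NE : (lebesgue_rV R d).-negligible (E `&` [set x | 0 < rho x]).
  apply: density_negligible => // C mC CE; rewrite -rhoX//.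
  apply/eqP; rewrite eq_le measure_ge0 andbT -E0; apply: le_measure.
  - by rewrite inE -[X in measurable X]setTI; exact: (measurable_funP X).
  - by rewrite inE -[X in measurable X]setTI; exact: (measurable_funP X).
  - by move=> w /CE.
have aeE : {ae lebesgue_rV R d, forall x, ~ (E `&` [set x | 0 < rho x]) x}.
  by apply: negligibleS NE => x /= /contrapT.
apply: filterS2 rho_pos aeE => x rx nEx Ox.
apply/eqP; rewrite eq_le valE (worst_cost_ge W0 sab Wb)//= leNgt; apply/negP => Wx.
by apply: nEx; split; [exact: HE|exact: rx].
Qed.
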